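(* Let $a=\tfrac14$, $d\neq\tfrac14$ and $b=e=0$. Then $\mathcal L=\mathcal L_{a,b,d,e}$ is a real Lie algebra of dimension $6$ with basis \begin{align*} v_1&=2tx\,\partial_x+2ty\,\partial_y+t^2\partial_t+\big(2(x+y)-2(\tfrac14+d)t\big)u\,\partial_u,\\ v_2&=x\,\partial_x+y\,\partial_y+t\,\partial_t,\qquad v_3=\partial_t,\\ v_4&=t\sqrt x\,\partial_x+2\sqrt x\,u\,\partial_u,\qquad v_5=\sqrt x\,\partial_x,\qquad v_6=u\,\partial_u, \end{align*} and $\mathcal L\cong\mathcal M\cong\mathcal H_{0,0}$.
   Context: All Lie algebras are real. For real constants $a,b,d,e$ consider the PDE $$\Delta:=(a-bx)u_x+(d-ey)u_y+\tfrac x2u_{xx}+\tfrac y2u_{yy}+u_t=0$$ for $u=u(x,y,t)$, $x,y>0$, $t\in\mathbb R$. An infinitesimal symmetry of the PDE is a smooth vector field $v=\xi\partial_x+\gamma\partial_y+\tau\partial_t+\phi\partial_u$ on $\{(x,y,t,u):x>0,y>0,t\in\mathbb R,u\in\mathbb R\}$, with $\xi,\gamma,\tau,\phi$ functions of $(x,y,t,u)$, whose second prolongation $\mathrm{pr}^{(2)}v$ satisfies $\mathrm{pr}^{(2)}v(\Delta)=0$ at all points of the second jet space where $\Delta=0$. $\mathcal V_{a,b,d,e}$ is the Lie algebra of all infinitesimal symmetries, under the Lie bracket of vector fields. For every $v\in\mathcal V_{a,b,d,e}$ the coefficient $\phi$ is affine in $u$: $\phi=\lambda_v(x,y,t)u+\mu_v(x,y,t)$.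 Set $\mathcal L_{a,b,d,e}=\{v\in\mathcal V_{a,b,d,e}:\mu_v=0\}$. $\mathcal M$ is the 6-dimensional real Lie algebra with basis $E,F,H,X,Y,Z$ and nonzero brackets (up to antisymmetry) $[E,F]=H$, $[H,E]=2E$, $[H,F]=-2F$, $[X,Y]=Z$, $[E,Y]=X$, $[F,X]=Y$, $[H,X]=X$, $[H,Y]=-Y$; thus $\mathcal M\cong\mathfrak{sl}_2\ltimes\mathfrak h_3$ with $\mathfrak h_3=\langle X,Y,Z\rangle$ the Heisenberg algebra. $\mathcal H_{0,0}$ is the 6-dimensional Lie symmetry algebra of the heat equation $\frac{\partial u}{\partial t}=-\frac{\partial^2u}{\partial q^2}$ for $u=u(t,q)$ (the symmetries coming from linear superposition of solutions being left out).
   Formalization: The case d = 3/4 is excluded as well as d = 1/4: for d = 3/4 the field √y ∂_y − (u/(2√y)) ∂_u is a further element of 𝓛 outside the span of v_1,…,v_6, so the claim as stated fails there. *)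

(* Defs.v *)
(* Stdlib reals with Coquelicot. *)
From Stdlib Require Import Reals List FinFun ClassicalEpsilon FunctionalExtensionality.
From Coquelicot Require Import Coquelicot.
Open Scope R_scope.

(** * Real Lie algebras *)

Section FunctionSpace.
Context (T : Type) (V : ModuleSpace R_Ring).

Definition fct_AbelianMonoid_mixin : AbelianMonoid.mixin_of (T -> V).
Proof.
apply (AbelianMonoid.Mixin (T -> V) (fun f g t => plus (f t) (g t)) (fun _ => zero));
  intros; extensionality t; [apply plus_comm | apply plus_assoc | apply plus_zero_r].
Defined.
Definition fct_AbelianMonoid := AbelianMonoid.Pack (T -> V) fct_AbelianMonoid_mixin (T -> V).

Definition fct_AbelianGroup_mixin : AbelianGroup.mixin_of fct_AbelianMonoid.
Proof.
apply (AbelianGroup.Mixin fct_AbelianMonoid (fun (f : T -> V) t => opp (f t))).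
intros f; extensionality t; exact (plus_opp_r (f t)).
Defined.
Definition fct_AbelianGroup := AbelianGroup.Pack (T -> V)
  (AbelianGroup.Class _ fct_AbelianMonoid_mixin fct_AbelianGroup_mixin) (T -> V).

Definition fct_ModuleSpace_mixin : ModuleSpace.mixin_of R_Ring fct_AbelianGroup.
Proof.
apply (ModuleSpace.Mixin R_Ring fct_AbelianGroup (fun (c : R) (f : T -> V) t => scal c (f t)));
  intros; extensionality t;
  [apply (@scal_assoc R_Ring V) | apply (@scal_one R_Ring V)
  | apply (@scal_distr_l R_Ring V) | apply (@scal_distr_r R_Ring V)].
Defined.
Definition fct_ModuleSpace : ModuleSpace R_Ring := ModuleSpace.Pack R_Ring (T -> V)
  (ModuleSpace.Class _ _ (AbelianGroup.class fct_AbelianGroup) fct_ModuleSpace_mixin) (T -> V).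
End FunctionSpace.

Section LieAlgebras.
Context {V : ModuleSpace R_Ring}.
Implicit Types (S : V -> Prop) (br : V -> V -> V) (l : list V).

(** The subset [S] of [V] is a real Lie algebra under [br]; nothing is required of [br]
    outside [S]. *)
Record is_lie_algebra S br : Prop := {
  lie_zero : S zero;
  lie_plus : forall v w, S v -> S w -> S (plus v w);
  lie_scal : forall (c : R) v, S v -> S (scal c v);
  lie_closed : forall v w, S v -> S w -> S (br v w);
  lie_plus_l : forall v v' w, S v -> S v' -> S w ->
    br (plus v v') w = plus (br v w) (br v' w);
  lie_scal_l : forall (c : R) v w, S v -> S w -> br (scal c v) w = scal c (br v w);
  lie_plus_r : forall v w w', S v -> S w -> S w' ->
    br v (plus w w') = plus (br v w) (br v w');
  lie_scal_r : forall (c : R) v w, S v -> S w -> br v (scal c w) = scal c (br v w);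
  lie_alt : forall v, S v -> br v v = zero;
  lie_jacobi : forall u v w, S u -> S v -> S w ->
    plus (br u (br v w)) (plus (br v (br w u)) (br w (br u v))) = zero }.

Definition lincomb (c : list R) l : V :=
  fold_right (fun p s => plus (scal (fst p : R) (snd p)) s) zero (combine c l).

Record is_basis S l : Prop := {
  basis_in : forall v, In v l -> S v;
  basis_free : forall c : list R, length c = length l -> lincomb c l = zero ->
    forall x, In x c -> x = 0;
  basis_span : forall v, S v -> exists c : list R, length c = length l /\ v = lincomb c l }.

Definition has_dim S (n : nat) := exists l, length l = n /\ is_basis S l.
End LieAlgebras.

Definition lie_isomorphic {V W : ModuleSpace R_Ring}
    (S : V -> Prop) (br : V -> V -> V) (S' : W -> Prop) (br' : W -> W -> W) : Prop :=
  is_lie_algebra S br /\ is_lie_algebra S' br' /\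
  exists f : V -> W,
    (forall v, S v -> S' (f v)) /\
    (forall v w, S v -> S w -> f (plus v w) = plus (f v) (f w)) /\
    (forall (c : R) v, S v -> f (scal c v) = scal c (f v)) /\
    (forall v w, S v -> S w -> f v = f w -> v = w) /\
    (forall w, S' w -> exists v, S v /\ f v = w) /\
    (forall v w, S v -> S w -> f (br v w) = br' (f v) (f w)).

(** * Calculus in finitely many named coordinates *)

Record index := Index {
  idx :> Type;
  idx_dec : forall i j : idx, {i = j} + {i <> j};
  idx_enum : list idx;
  idx_enumP : Listing idx_enum }.

(** Adjoins one coordinate, [None]: the dependent variable [u]. *)
Definition withU (I : index) : index.
Proof.
refine (Index (option I) _ (None :: map Some (idx_enum I)) _).
- decide equality; apply idx_dec.
- destruct (idx_enumP I) as [Hn Hf]; split.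
  + constructor.
    * intros H; apply in_map_iff in H; destruct H as [i [Hi _]]; discriminate.
    * apply Injective_map_NoDup; [intros i j Hij; now injection Hij | exact Hn].
  + intros [i|]; [right; apply in_map, Hf | now left].
Defined.

Definition isum {K : index} (f : K -> R) : R := fold_right Rplus 0 (map f (idx_enum K)).

Definition point (K : index) := K -> R.

Definition upd {K : index} (z : point K) (k : K) (s : R) : point K :=
  fun j => if idx_dec K j k then s else z j.

(** The points of a region [D]. Functions on [D] are functions on this type, so that their
    equality is equality on [D]. *)
Definition pt {K : index} (D : point K -> Prop) := {z : point K | D z}.
Definition pt_val {K : index} {D : point K -> Prop} (z : pt D) : point K := proj1_sig z.
Coercion pt_val : pt >-> point.

Section Calculus.
Context {K : index} {D : point K -> Prop}.
Implicit Types (f : pt D -> R) (z : pt D) (k : K).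

(** Extension by zero; for open [D], limits and derivatives at points of [D] do not depend on
    the values outside [D]. *)
Definition ext f (z : point K) : R :=
  match excluded_middle_informative (D z) with
  | left h => f (exist D z h)
  | right _ => 0
  end.

Definition ex_partial k f z := ex_derive (fun s => ext f (upd z k s)) ((z : point K) k).
Definition partial k f : pt D -> R :=
  fun z => Derive (fun s => ext f (upd z k s)) ((z : point K) k).

(** [continuous] is taken in the uniform structure of [K -> R], which is that of the
    finite-dimensional space [R^K]. *)
Fixpoint Cn (n : nat) f : Prop :=
  (forall z, continuous (ext f) (pt_val z)) /\
  match n with
  | O => True
  | S m => forall k, (forall z, ex_partial k f z) /\ Cn m (partial k f)
  end.
Definition smooth f := forall n, Cn n f.

(** [v k] is the coefficient of [v] along the coordinate field of [k]. *)
Definition vfield := K -> pt D -> R.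
Definition vbracket (v w : vfield) : vfield := fun k z =>
  isum (fun j => v j z * partial j (w k) z - w j z * partial j (v k) z).
End Calculus.
Arguments vfield {K} D.

Definition vspace {K : index} (D : point K -> Prop) : ModuleSpace R_Ring :=
  fct_ModuleSpace K (fct_ModuleSpace (pt D) (R_ModuleSpace)).

(** * Infinitesimal symmetries of second order equations *)

(** A second order equation for [u = u(x)], [x = (x_i)], is [Delta z p q = 0], with [z = (x, u)],
    [p i] standing for [u_i] and [q i j] for [u_{ij}]. *)
Definition jet_function (I : index) := point (withU I) -> (I -> R) -> (I -> I -> R) -> R.

Section Symmetries.
Context {I : index} {D : point (withU I) -> Prop}.
Notation x_ i := (Some i : withU I).
Notation u_ := (None : withU I).
Implicit Types (z : pt D) (p : I -> R) (q : I -> I -> R) (v : vfield D).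

(** Total derivatives [D_i], of a function of [(x, u)] and of one of [(x, u, p)]. *)
Definition total0 (i : I) (f : pt D -> R) z p : R :=
  partial (x_ i) f z + p i * partial u_ f z.
Definition total1 (i : I) (g : pt D -> (I -> R) -> R) z p q : R :=
  partial (x_ i) (fun y => g y p) z + p i * partial u_ (fun y => g y p) z
  + isum (fun k => q i k * Derive (fun s => g z (upd p k s)) (p k)).

(** The prolongation coefficients, by the recursion
    [phi^i = D_i phi - sum_k u_k D_i xi^k] and
    [phi^{ij} = D_j phi^i - sum_k u_{ik} D_j xi^k]. *)
Definition pr1 v (i : I) z p : R :=
  total0 i (v u_) z p - isum (fun k => p k * total0 i (v (x_ k)) z p).
Definition pr2 v (i j : I) z p q : R :=
  total1 j (pr1 v i) z p q - isum (fun k => q i k * total0 j (v (x_ k)) z p).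

(** [pr^(2) v (Delta)], as the derivative of [Delta] in the direction of [pr^(2) v]. *)
Definition pr2_apply v (Delta : jet_function I) z p q : R :=
  Derive (fun s => Delta (fun k => (z : point (withU I)) k + s * v k z)
                         (fun i => p i + s * pr1 v i z p)
                         (fun i j => q i j + s * pr2 v i j z p q)) 0.

Definition is_symmetry (Delta : jet_function I) v : Prop :=
  (forall k, smooth (v k)) /\
  forall z p q, (forall i j, q i j = q j i) ->
    Delta z p q = 0 -> pr2_apply v Delta z p q = 0.

(** The symmetries with [phi = lambda(x) u], that is, [phi = lambda(x) u + mu(x)] with [mu = 0]. *)
Definition is_linear_symmetry (Delta : jet_function I) v : Prop :=
  is_symmetry Delta v /\
  exists lambda : point I -> R, forall z,
    v u_ z = lambda (fun i => (z : point (withU I)) (x_ i)) * (z : point (withU I)) u_.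
End Symmetries.

(** * The two-dimensional equation *)

Inductive xyt := cx | cy | ct.
Definition xyt_index : index.
Proof.
refine (Index xyt _ (cx :: cy :: ct :: nil) _).
- decide equality.
- split; [repeat constructor; simpl; intuition discriminate | intros []; simpl; tauto].
Defined.

Definition quadrant (z : point (withU xyt_index)) : Prop := 0 < z (Some cx) /\ 0 < z (Some cy).

Definition Delta2 (a b d e : R) : jet_function xyt_index := fun z p q =>
  let x := z (Some cx) in
  let y := z (Some cy) in
  (a - b * x) * p cx + (d - e * y) * p cy + x / 2 * q cx cx + y / 2 * q cy cy + p ct.

Definition calL (a b d e : R) : vspace quadrant -> Prop :=
  is_linear_symmetry (D := quadrant) (Delta2 a b d e).

(** The field [xi d_x + gamma d_y + tau d_t + phi d_u], from its coefficients as functions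
    of [x y t u]. *)
Definition field4 (xi gamma tau phi : R -> R -> R -> R -> R) : vspace quadrant :=
  fun k z =>
    let c (f : R -> R -> R -> R -> R) :=
      f (pt_val z (Some cx)) (pt_val z (Some cy)) (pt_val z (Some ct)) (pt_val z None) in
    match k with
    | Some cx => c xi
    | Some cy => c gamma
    | Some ct => c tau
    | None => c phi
    end.

Definition v1 (d : R) := field4
  (fun x y t u => 2 * t * x) (fun x y t u => 2 * t * y) (fun x y t u => t ^ 2)
  (fun x y t u => (2 * (x + y) - 2 * (1 / 4 + d) * t) * u).
Definition v2 := field4
  (fun x y t u => x) (fun x y t u => y) (fun x y t u => t) (fun x y t u => 0).
Definition v3 := field4
  (fun x y t u => 0) (fun x y t u => 0) (fun x y t u => 1) (fun x y t u => 0).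
Definition v4 := field4
  (fun x y t u => t * sqrt x) (fun x y t u => 0) (fun x y t u => 0)
  (fun x y t u => 2 * sqrt x * u).
Definition v5 := field4
  (fun x y t u => sqrt x) (fun x y t u => 0) (fun x y t u => 0) (fun x y t u => 0).
Definition v6 := field4
  (fun x y t u => 0) (fun x y t u => 0) (fun x y t u => 0) (fun x y t u => u).

(** * The heat equation [u_t = - u_qq] *)

Inductive tq := ht | hq.
Definition tq_index : index.
Proof.
refine (Index tq _ (ht :: hq :: nil) _).
- decide equality.
- split; [repeat constructor; simpl; intuition discriminate | intros []; simpl; tauto].
Defined.

Definition plane (z : point (withU tq_index)) : Prop := True.

Definition heat : jet_function tq_index := fun z p q => p ht + q hq hq.

Definition calH00 : vspace plane -> Prop := is_linear_symmetry (D := plane) heat.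

(** * The algebra [M] *)

Inductive mgen := gE | gF | gH | gX | gY | gZ.
Definition mgens := gE :: gF :: gH :: gX :: gY :: gZ :: nil.
Definition mgen_dec (i j : mgen) : {i = j} + {i <> j}.
Proof. decide equality. Defined.

Definition calM : ModuleSpace R_Ring := fct_ModuleSpace mgen R_ModuleSpace.
Definition gen (i : mgen) : calM := fun k => if mgen_dec k i then 1 else 0.

(** One of the two orders for each pair of generators that do not commute. *)
Definition mtable (i j : mgen) : calM :=
  match i, j with
  | gE, gF => gen gH
  | gH, gE => scal 2 (gen gE)
  | gH, gF => scal (-2) (gen gF)
  | gX, gY => gen gZ
  | gE, gY => gen gX
  | gF, gX => gen gY
  | gH, gX => gen gX
  | gH, gY => opp (gen gY)
  | _, _ => zero
  end.

Definition mbracket (m n : calM) : calM := fun k =>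
  fold_right Rplus 0 (map (fun i => fold_right Rplus 0 (map (fun j =>
    m i * n j * (mtable i j k - mtable j i k)) mgens)) mgens).

Definition allM : calM -> Prop := fun _ => True.

(* Main.v *)
Require Import Defs.
From Stdlib Require Import Reals List.
From Stdlib Require Import Lra ClassicalEpsilon FunctionalExtensionality ProofIrrelevance.
From Coquelicot Require Import Coquelicot.
Import ListNotations.
Open Scope R_scope.

(** Both symmetry algebras are parametrized explicitly by [calM], so that the brackets, the basis
    and the isomorphisms reduce to polynomial identities. The content is that there are no other
    symmetries. The part of the determining equation that is linear in the second derivatives
    forces the coefficient [tau] of [d_t] to depend on [t] only and the coefficients of the other
    base fields not to depend on [u]. What remains is integrated directly: for the
    two-dimensional equation
      [xi = tau' x + (al + 2 k sqrt y) sqrt x],  [gamma = tau' y + (be - 2 k sqrt x) sqrt y]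
    with functions [al], [be], [k] of [t]; [lambda_x] and [lambda_y] are then known, their
    compatibility gives [k' = 0], and the equation for [lambda] contains the terms
      [(d - 1/4) (d - 3/4) (be / 2 - k sqrt x) / sqrt y ^ 3],
    whence [k = be = 0], together with [tau''' = al'' = 0]. *)

(** In the coordinates r = 2 sqrt x, s = 2 sqrt y the operator is (u_rr + u_ss) / 2 + (2 (d - 1/4) /
    s) u_s + u_t; the value a = 1/4 is exactly the one that leaves no first derivative in r. The
    principal part is flat, so at each time a base field combines a dilation, governed by tau', a
    rotation [k] and translations [al], [be]. Writing u = y^(1/4 - d) w removes u_s and leaves the
    potential - (d - 1/4) (d - 3/4) / (2 y). Neither the rotation nor the translation in s preserves
    it unless its coefficient vanishes; this is the origin of the product (d - 1/4) (d - 3/4). What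
    survives acts in r and t like the symmetries of the one-dimensional heat equation, so both
    algebras receive the same parametrization by [calM]. The unknown coefficients are only known to
    be smooth. Each is brought into explicit form by integrating one equation along a coordinate
    line, and the identity so obtained is then differentiated in the other variables. *)

(* These let [Some cx] and [None] be read as coordinates of the indices of [Defs]. *)
Local Canonical withU.
Local Canonical tq_index.
Local Canonical xyt_index.

(** * Transport of Lie algebra structures *)

Section Transport.
Context {V W : ModuleSpace R_Ring}.
Variables (S : V -> Prop) (br : V -> V -> V) (S' : W -> Prop) (br' : W -> W -> W) (f : V -> W).
Hypotheses
  (f_in : forall v, S v -> S' (f v))
  (f_plus : forall v w, S v -> S w -> f (plus v w) = plus (f v) (f w))
  (f_scal : forall (c : R) v, S v -> f (scal c v) = scal c (f v))
  (f_inj : forall v w, S v -> S w -> f v = f w -> v = w)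
  (f_surj : forall w, S' w -> exists v, S v /\ f v = w)
  (f_br : forall v w, S v -> S w -> f (br v w) = br' (f v) (f w))
  (lieS : is_lie_algebra S br).

Lemma transport_zero : f zero = zero.
Proof using f_scal lieS.
  rewrite <- (scal_zero_l (zero : V)), f_scal by apply (lie_zero _ _ lieS).
  apply scal_zero_l.
Qed.

(** By surjectivity every element of [S'] is an image, so each axiom on [S'] is the corresponding
    axiom on [S] pushed through [f]. *)
Lemma is_lie_algebra_image : is_lie_algebra S' br'.
Proof using All.
  pose proof transport_zero as f0.
  destruct lieS as [S0 SD SZ SB Dl Zl Dr Zr Alt Jac].
  constructor.
  - rewrite <- f0; auto.
  - intros v w Hv Hw.
    destruct (f_surj v Hv) as [x [Sx <-]], (f_surj w Hw) as [y [Sy <-]].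
    rewrite <- f_plus; auto.
  - intros c v Hv; destruct (f_surj v Hv) as [x [Sx <-]].
    rewrite <- f_scal; auto.
  - intros v w Hv Hw.
    destruct (f_surj v Hv) as [x [Sx <-]], (f_surj w Hw) as [y [Sy <-]].
    rewrite <- f_br; auto.
  - intros u v w Hu Hv Hw.
    destruct (f_surj u Hu) as [x [Sx <-]], (f_surj v Hv) as [y [Sy <-]],
      (f_surj w Hw) as [z [Sz <-]].
    rewrite <- f_plus, <- !f_br, <- f_plus, Dl; auto.
  - intros c v w Hv Hw.
    destruct (f_surj v Hv) as [x [Sx <-]], (f_surj w Hw) as [y [Sy <-]].
    rewrite <- f_scal, <- !f_br, <- f_scal, Zl; auto.
  - intros u v w Hu Hv Hw.
    destruct (f_surj u Hu) as [x [Sx <-]], (f_surj v Hv) as [y [Sy <-]],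
      (f_surj w Hw) as [z [Sz <-]].
    rewrite <- f_plus, <- !f_br, <- f_plus, Dr; auto.
  - intros c v w Hv Hw.
    destruct (f_surj v Hv) as [x [Sx <-]], (f_surj w Hw) as [y [Sy <-]].
    rewrite <- f_scal, <- !f_br, <- f_scal, Zr; auto.
  - intros v Hv; destruct (f_surj v Hv) as [x [Sx <-]].
    rewrite <- f_br, Alt; auto.
  - intros u v w Hu Hv Hw.
    destruct (f_surj u Hu) as [x [Sx <-]], (f_surj v Hv) as [y [Sy <-]],
      (f_surj w Hw) as [z [Sz <-]].
    rewrite <- !f_br by auto.
    rewrite <- !f_plus, Jac by auto.
    exact f0.
Qed.

Lemma lie_isomorphic_image : lie_isomorphic S br S' br'.
Proof using All.
  split; [exact lieS | split; [exact is_lie_algebra_image | exists f; auto 8]].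
Qed.
End Transport.

Lemma lie_isomorphic_sym {V W : ModuleSpace R_Ring}
    (S : V -> Prop) (br : V -> V -> V) (S' : W -> Prop) (br' : W -> W -> W) :
  lie_isomorphic S br S' br' -> lie_isomorphic S' br' S br.
Proof.
  intros [lieS [lieS' [f [f_in [f_plus [f_scal [f_inj [f_surj f_br]]]]]]]].
  split; [exact lieS' | split; [exact lieS |]].
  (* [lie_isomorphic] asks of its map only what it does on the subset, so an arbitrary choice of [g]
     off [S'] is harmless. *)
  pose (g := fun w => epsilon (inhabits (zero : V)) (fun v => S v /\ f v = w)).
  assert (Hg : forall w, S' w -> S (g w) /\ f (g w) = w)
    by (intros w Hw; apply epsilon_spec, f_surj, Hw).
  assert (gin : forall w, S' w -> S (g w)) by apply Hg.
  assert (fg : forall w, S' w -> f (g w) = w) by apply Hg.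
  assert (gf : forall v, S v -> g (f v) = v)
    by (intros v Hv; apply f_inj; [apply gin | | apply fg]; auto).
  pose proof (lie_plus _ _ lieS) as SD; pose proof (lie_scal _ _ lieS) as SZ.
  pose proof (lie_closed _ _ lieS) as SB.
  exists g; repeat split; auto.
  - intros v w Hv Hw.
    rewrite <- (gf (plus (g v) (g w))), f_plus, !fg; auto.
  - intros c v Hv.
    rewrite <- (gf (scal c (g v))), f_scal, fg; auto.
  - intros v w Hv Hw E; rewrite <- (fg v Hv), E; auto.
  - intros v Hv; exists (f v); auto.
  - intros v w Hv Hw.
    rewrite <- (gf (br (g v) (g w))), f_br, !fg; auto.
Qed.

Lemma is_lie_algebra_calM : is_lie_algebra allM mbracket.
Proof.
  constructor; try (intros; exact I); intros;
    extensionality k; destruct k; cbn; ring.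
Qed.

(** The Lie axioms are checked in [calM], where they are polynomial identities in six coordinates,
    and carried over by [G]. For vector fields a direct proof of the Jacobi identity would involve
    the symmetry of second partial derivatives, and closure would require prolonging brackets. *)
Lemma lie_model {W : ModuleSpace R_Ring} (S : W -> Prop) (br : W -> W -> W) (G : calM -> W) :
  (forall m, S (G m)) ->
  (forall m n, G (plus m n) = plus (G m) (G n)) ->
  (forall (c : R) m, G (scal c m) = scal c (G m)) ->
  (forall m n, G m = G n -> m = n) ->
  (forall w, S w -> exists m, G m = w) ->
  (forall m n, G (mbracket m n) = br (G m) (G n)) ->
  is_lie_algebra S br /\ lie_isomorphic S br allM mbracket /\ lie_isomorphic allM mbracket S br.
Proof.
  intros Gin GD GZ Ginj Gsurj GB.
  assert (H : lie_isomorphic allM mbracket S br).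
  { apply (lie_isomorphic_image allM mbracket S br G); auto using is_lie_algebra_calM.
    intros w Hw; destruct (Gsurj w Hw) as [m Hm]; exists m; split; [exact I | exact Hm]. }
  split; [apply H | split; [apply lie_isomorphic_sym, H | exact H]].
Qed.

(** * Calculus in named coordinates *)

Lemma is_derive_Rplus (f g : R -> R) x l m :
  is_derive f x l -> is_derive g x m -> is_derive (fun s => f s + g s) x (l + m).
Proof. apply (is_derive_plus (V := R_NormedModule)). Qed.

Lemma is_derive_Rmult (f g : R -> R) x l m :
  is_derive f x l -> is_derive g x m ->
  is_derive (fun s => f s * g s) x (l * g x + f x * m).
Proof. intros Hf Hg; apply (is_derive_mult f g); auto; apply Rmult_comm. Qed.

Section NamedCoordinates.
Context {K : index}.
Implicit Types (z w : point K) (k : K).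

Lemma upd_same z k s : upd z k s k = s.
Proof. unfold upd; destruct (idx_dec K k k); tauto. Qed.

Lemma upd_id z k : upd z k (z k) = z.
Proof.
  extensionality j; unfold upd; destruct (idx_dec K j k); congruence.
Qed.

Lemma continuous_coord z k : continuous (fun w => w k) z.
Proof.
  intros P [eps HP]; exists eps; intros w Hw; apply HP, Hw.
Qed.

Context {D : point K -> Prop} (HD : open D).
Implicit Types (f g : pt D -> R).

Lemma ext_in f z (h : D z) : ext f z = f (exist D z h).
Proof.
  unfold ext; destruct (excluded_middle_informative (D z)); [|tauto].
  do 2 f_equal; apply proof_irrelevance.
Qed.

Lemma ext_pt f (z : pt D) : ext f z = f z.
Proof. destruct z as [z h]; apply ext_in. Qed.

(** An operation that sends the pair of zeros to zero commutes with extension by zero. Sums and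
    products qualify, so their rules apply to the extensions themselves. *)
Lemma ext_lift2 (op : R -> R -> R) f g : op 0 0 = 0 ->
  ext (fun y => op (f y) (g y)) = fun y => op (ext f y) (ext g y).
Proof.
  intros H; extensionality z; unfold ext.
  destruct (excluded_middle_informative (D z)); congruence.
Qed.

Lemma locally_upd (z : pt D) k : locally ((z : point K) k) (fun s => D (upd z k s)).
Proof using HD.
  destruct z as [z h]; cbn.
  destruct (HD z h) as [eps He]; exists eps; intros s Hs; apply He.
  intros j; unfold upd; destruct (idx_dec K j k) as [->|]; [exact Hs | apply ball_center].
Qed.

(** * Functions on an open region given by a formula on the whole coordinate space *)

Section Represented.
Variables (f : pt D -> R) (F : point K -> R).
Hypothesis fF : forall z : pt D, f z = F z.

Lemma ext_represented z : D z -> ext f z = F z.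
Proof using fF. intros h; rewrite (ext_in f z h); apply fF. Qed.

Lemma continuous_represented (z : pt D) :
  continuous F (z : point K) -> continuous (ext f) (z : point K).
Proof using fF HD.
  apply continuous_ext_loc.
  destruct z as [z h]; generalize (HD z h); apply filter_imp.
  intros w Dw; symmetry; apply ext_represented, Dw.
Qed.

(** Near a point of the open set [D] the extension by zero agrees with [F], so derivatives can be
    computed from the formula, whatever its values off [D]. *)
Lemma is_derive_represented k (z : pt D) l :
  is_derive (fun s => F (upd z k s)) ((z : point K) k) l ->
  is_derive (fun s => ext f (upd z k s)) ((z : point K) k) l.
Proof using fF HD.
  apply is_derive_ext_loc; generalize (locally_upd z k); apply filter_imp.
  intros s Ds; symmetry; apply ext_represented, Ds.
Qed.

Lemma partial_represented k (z : pt D) l :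
  is_derive (fun s => F (upd z k s)) ((z : point K) k) l -> partial k f z = l.
Proof using fF HD. intros H; apply is_derive_unique, is_derive_represented, H. Qed.
End Represented.

Lemma is_derive_partial k f (z : pt D) : ex_partial k f z ->
  is_derive (fun s => ext f (upd z k s)) ((z : point K) k) (partial k f z).
Proof. apply Derive_correct. Qed.

Lemma Cn_partial n f k : Cn (S n) f -> Cn n (partial k f).
Proof. intros [_ H]; apply H. Qed.

Lemma Cn_ex_partial n f k (z : pt D) : Cn (S n) f -> ex_partial k f z.
Proof. intros [_ H]; apply H. Qed.

Lemma Cn_pred n f : Cn (S n) f -> Cn n f.
Proof.
  revert f; induction n as [|n IH]; intros f H.
  - destruct H as [H _]; split; auto.
  - destruct H as [Hc H]; split; [exact Hc|]; intros k; destruct (H k) as [He Hk].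
    split; [exact He | apply IH, Hk].
Qed.

Lemma smooth_partial f k : smooth f -> smooth (partial k f).
Proof. intros H n; apply Cn_partial, H. Qed.

Lemma smooth_ex_partial f k (z : pt D) : smooth f -> ex_partial k f z.
Proof. intros H; apply (Cn_ex_partial 0), H. Qed.

Lemma smooth_eq f g : (forall y, f y = g y) -> smooth g -> smooth f.
Proof. intros H; replace f with g; [auto | extensionality z; auto]. Qed.

Lemma Cn_const n (c : R) : Cn n (fun _ : pt D => c).
Proof using HD.
  assert (Hp : forall c' k (z : pt D),
      is_derive (fun s => ext (fun _ : pt D => c') (upd z k s)) ((z : point K) k) 0).
  { intros c' k z.
    apply (is_derive_represented _ (fun _ => c')); [reflexivity | apply (is_derive_const c')]. }
  revert c; induction n as [|n IH]; intros c;
    (split; [intros z; apply (continuous_represented _ (fun _ => c));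
             [reflexivity | apply continuous_const] |]); [exact I|].
  intros k; split.
  - intros z; exists 0; apply Hp.
  - replace (partial k (fun _ : pt D => c)) with (fun _ : pt D => 0); [apply IH|].
    extensionality z; symmetry; apply is_derive_unique, Hp.
Qed.

Lemma smooth_const (c : R) : smooth (fun _ : pt D => c).
Proof using HD. intros n; apply Cn_const. Qed.

Lemma smooth_coord k : smooth (fun z : pt D => (z : point K) k).
Proof using HD.
  assert (Hp : forall j (z : pt D),
      is_derive (fun s => ext (fun z : pt D => (z : point K) k) (upd z j s)) ((z : point K) j)
        (if idx_dec K k j then 1 else 0)).
  { intros j z; apply (is_derive_represented _ (fun w => w k)); [reflexivity|].
    unfold upd; destruct (idx_dec K k j);
      [apply (is_derive_id (K := R_AbsRing)) | apply (is_derive_const ((z : point K) k))]. }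
  intros n; destruct n as [|n]; split; try exact I;
    try (intros z; apply (continuous_represented _ (fun w => w k));
         [reflexivity | apply continuous_coord]).
  intros j; split.
  - intros z; eexists; apply Hp.
  - replace (partial j _) with (fun _ : pt D => if idx_dec K k j then 1 else 0);
      [apply Cn_const|].
    extensionality z; symmetry; apply is_derive_unique, Hp.
Qed.

Lemma is_derive_ext_plus f g k (z : pt D) : ex_partial k f z -> ex_partial k g z ->
  is_derive (fun s => ext (fun y => f y + g y) (upd z k s)) ((z : point K) k)
    (partial k f z + partial k g z).
Proof.
  intros Hf Hg; rewrite (ext_lift2 Rplus) by ring.
  apply is_derive_Rplus; apply is_derive_partial; assumption.
Qed.

Lemma is_derive_ext_mult f g k (z : pt D) : ex_partial k f z -> ex_partial k g z ->
  is_derive (fun s => ext (fun y => f y * g y) (upd z k s)) ((z : point K) k)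
    (partial k f z * g z + f z * partial k g z).
Proof.
  intros Hf Hg; rewrite (ext_lift2 Rmult) by ring.
  assert (E : forall h, h z = ext h (upd z k ((z : point K) k)))
    by (intros h; rewrite upd_id, ext_pt; reflexivity).
  rewrite (E f), (E g).
  apply (is_derive_Rmult (fun s => ext f (upd z k s)) (fun s => ext g (upd z k s)));
    apply is_derive_partial; assumption.
Qed.

Lemma Cn_continuous n f (z : pt D) : Cn n f -> continuous (ext f) (z : point K).
Proof. destruct n; intros [H _]; apply H. Qed.

Lemma Cn_plus n f g : Cn n f -> Cn n g -> Cn n (fun y => f y + g y).
Proof.
  revert f g; induction n as [|n IH]; intros f g Hf Hg;
    (split; [intros z; rewrite (ext_lift2 Rplus) by ring;
             apply (continuous_plus (ext f) (ext g)); eapply Cn_continuous; eassumption |]);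
    [exact I|].
  intros k; split.
  - intros z; eexists; apply is_derive_ext_plus; eapply Cn_ex_partial; eassumption.
  - replace (partial k _) with (fun y => partial k f y + partial k g y);
      [apply IH; apply Cn_partial; assumption|].
    extensionality z; symmetry; apply is_derive_unique, is_derive_ext_plus;
      eapply Cn_ex_partial; eassumption.
Qed.

Lemma Cn_mult n f g : Cn n f -> Cn n g -> Cn n (fun y => f y * g y).
Proof.
  revert f g; induction n as [|n IH]; intros f g Hf Hg;
    (split; [intros z; rewrite (ext_lift2 Rmult) by ring;
             apply (continuous_mult (ext f) (ext g)); eapply Cn_continuous; eassumption |]);
    [exact I|].
  intros k; split.
  - intros z; eexists; apply is_derive_ext_mult; eapply Cn_ex_partial; eassumption.
  - replace (partial k _) with (fun y => partial k f y * g y + f y * partial k g y);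
      (* The product rule pairs a derivative with an undifferentiated factor, hence the step down
         from order [S n] to [n] for the latter. *)
      [apply Cn_plus; apply IH; try (apply Cn_partial; assumption); apply Cn_pred; assumption|].
    extensionality z; symmetry; apply is_derive_unique, is_derive_ext_mult;
      eapply Cn_ex_partial; eassumption.
Qed.

Lemma smooth_plus f g : smooth f -> smooth g -> smooth (fun y => f y + g y).
Proof. intros Hf Hg n; apply Cn_plus; auto. Qed.

Lemma smooth_mult f g : smooth f -> smooth g -> smooth (fun y => f y * g y).
Proof. intros Hf Hg n; apply Cn_mult; auto. Qed.

Lemma smooth_opp f : smooth f -> smooth (fun y => - f y).
Proof using HD.
  intros Hf; apply (smooth_eq _ (fun y => -1 * f y)); [intros y; ring|].
  apply smooth_mult; [apply smooth_const | exact Hf].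
Qed.

Section SquareRoot.
Variable k : K.
Hypothesis k_pos : forall z, D z -> 0 < z k.

Let r (y : pt D) := / sqrt ((y : point K) k).

Lemma is_derive_inv_sqrt x : 0 < x ->
  is_derive (fun s => / sqrt s) x (-1 / 2 * (/ sqrt x * / sqrt x * / sqrt x)).
Proof.
  intros Hx; pose proof (sqrt_lt_R0 x Hx) as Hs.
  auto_derive; [split; [exact Hx | split; [lra | exact I]] | field; lra].
Qed.

(* Every derivative of x^(-1/2) is a polynomial in x^(-1/2). *)
Lemma smooth_inv_sqrt : smooth r.
Proof using HD k_pos.
  pose (c := fun j => if idx_dec K k j then -1 / 2 else 0).
  assert (Hp : forall j (z : pt D),
      is_derive (fun s => ext r (upd z j s)) ((z : point K) j) (c j * (r z * r z * r z))).
  { intros j z; apply (is_derive_represented _ (fun w => / sqrt (w k))); [reflexivity|].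
    unfold c, upd; destruct (idx_dec K k j) as [<-|].
    - apply is_derive_inv_sqrt, k_pos, (proj2_sig z).
    - rewrite Rmult_0_l; apply (is_derive_const (/ sqrt ((z : point K) k))). }
  assert (Hc : forall z : pt D, continuous (ext r) (z : point K)).
  { intros z; apply (continuous_represented _ (fun w => / sqrt (w k))); [reflexivity|].
    apply (continuous_comp (fun w : point K => w k) (fun s => / sqrt s));
      [apply continuous_coord|].
    apply (ex_derive_continuous (V := R_NormedModule)).
    eexists; apply is_derive_inv_sqrt, k_pos, (proj2_sig z). }
  intros n; induction n as [|n IH]; (split; [exact Hc|]); [exact I|].
  intros j; split.
  - intros z; eexists; apply Hp.
  - replace (partial j r) with (fun y => c j * (r y * r y * r y)).
    + apply Cn_mult; [apply Cn_const | apply Cn_mult; [apply Cn_mult|]; exact IH].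
    + extensionality z; symmetry; apply is_derive_unique, Hp.
Qed.

(** sqrt x = x * x^(-1/2) reduces the claim to the inverse root, whose powers are closed under
    differentiation. *)
Lemma smooth_sqrt : smooth (fun y : pt D => sqrt ((y : point K) k)).
Proof using HD k_pos.
  apply (smooth_eq _ (fun y => (y : point K) k * r y)).
  - intros y; unfold r.
    pose proof (k_pos y (proj2_sig y)) as Hk; pose proof (sqrt_lt_R0 _ Hk) as Hs.
    rewrite <- (sqrt_sqrt ((y : point K) k)) at 2 by lra.
    field; lra.
  - apply smooth_mult; [apply smooth_coord | apply smooth_inv_sqrt].
Qed.
End SquareRoot.
End NamedCoordinates.

Ltac smooth_tac HD tac :=
  unfold Rminus, Rdiv; cbn [pow];
  repeat first
    [ apply (smooth_const HD)
    | apply (smooth_coord HD)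
    | tac
    | apply smooth_plus
    | apply smooth_mult
    | apply (smooth_opp HD) ].

(** * Functions determined by their derivatives, through the mean value theorem *)

Lemma increment_unique (f g df : R -> R) a b :
  (forall s, Rmin a b <= s <= Rmax a b -> is_derive f s (df s)) ->
  (forall s, Rmin a b <= s <= Rmax a b -> is_derive g s (df s)) ->
  f b - f a = g b - g a.
Proof.
  intros Hf Hg.
  assert (Hd : forall s, Rmin a b <= s <= Rmax a b -> is_derive (fun s => f s - g s) s 0).
  { intros s Hs; rewrite <- (Rminus_diag (df s)).
    apply (is_derive_minus f g s (df s) (df s)); auto. }
  destruct (MVT_gen (fun s => f s - g s) a b (fun _ => 0)) as [c [_ Hc]].
  - intros s Hs; apply Hd; lra.
  - intros s Hs; apply continuity_pt_filterlim, (ex_derive_continuous (fun s => f s - g s)).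
    exists 0; auto.
  - lra.
Qed.

Lemma constant_of_derive_zero (f : R -> R) a b :
  (forall s, Rmin a b <= s <= Rmax a b -> is_derive f s 0) -> f a = f b.
Proof.
  intros Hf.
  enough (f b - f a = 0 - 0) by lra.
  apply (increment_unique f (fun _ => 0) (fun _ => 0)); [exact Hf|].
  intros s _; apply (is_derive_const 0).
Qed.

(** The mean value argument runs along one coordinate line, so the segment between the two points
    has to stay in [D]. *)
Lemma constant_of_partial_zero {K : index} {D : point K -> Prop} (f : pt D -> R) k
    (z : point K) s :
  (forall r, Rmin (z k) s <= r <= Rmax (z k) s -> D (upd z k r)) ->
  smooth f -> (forall y, partial k f y = 0) ->
  ext f (upd z k s) = ext f z.
Proof.
  intros HD Hf H0; symmetry.
  rewrite <- (upd_id z k) at 1.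
  apply (constant_of_derive_zero (fun r => ext f (upd z k r))).
  intros r Hr; pose proof (HD r Hr) as h.
  pose proof (is_derive_partial k f (exist _ _ h) (smooth_ex_partial f k _ Hf)) as H.
  rewrite H0 in H; cbn in H; rewrite upd_same in H.
  revert H; apply is_derive_ext; intros w; f_equal.
  extensionality j; unfold upd; destruct (idx_dec K j k); reflexivity.
Qed.

Lemma is_derive_Rmult_const (f : R -> R) x l c :
  is_derive f x l -> is_derive (fun s => f s * c) x (l * c).
Proof.
  intros Hf; replace (l * c) with (l * c + f x * 0) by ring.
  apply (is_derive_Rmult f (fun _ => c)); [exact Hf | apply (is_derive_const c)].
Qed.

(* Elaboration leaves both [option (idx xyt_index)] and [option xyt] in terms; [ring] and [lra]
   see atoms that differ there as distinct. *)
Ltac coord_norm :=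
  change (idx tq_index) with tq in *; change (idx xyt_index) with xyt in *.
Ltac coord_ring := coord_norm; ring.
Ltac coord_lra := coord_norm; lra.

(** * The heat equation *)

Definition tqu (t q u : R) : point (withU tq_index) := fun k =>
  match k with Some ht => t | Some hq => q | None => u end.

Lemma tqu_eta (z : point (withU tq_index)) : z = tqu (z (Some ht)) (z (Some hq)) (z None).
Proof. extensionality k; destruct k as [[]|]; reflexivity. Qed.

Lemma tqu_upd_t t q u s : upd (tqu t q u) (Some ht) s = tqu s q u.
Proof. extensionality k; destruct k as [[]|]; reflexivity. Qed.

Lemma tqu_upd_q t q u s : upd (tqu t q u) (Some hq) s = tqu t s u.
Proof. extensionality k; destruct k as [[]|]; reflexivity. Qed.

Lemma tqu_upd_u t q u s : upd (tqu t q u) None s = tqu t q s.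
Proof. extensionality k; destruct k as [[]|]; reflexivity. Qed.

Lemma open_plane : open plane.
Proof. intros z _; exists (mkposreal 1 Rlt_0_1); intros; exact I. Qed.

Definition plane_pt (z : point (withU tq_index)) : pt plane := exist plane z I.

Section HeatPartials.
Variables (f : pt plane -> R) (F : R -> R -> R -> R).
Hypothesis fF : forall z : pt plane,
  f z = F (pt_val z (Some ht)) (pt_val z (Some hq)) (pt_val z None).

Lemma heat_partial_t (z : pt plane) l :
  is_derive (fun s => F s (pt_val z (Some hq)) (pt_val z None)) (pt_val z (Some ht)) l ->
  partial (Some ht) f z = l.
Proof using fF.
  apply (partial_represented open_plane f (fun w => F (w (Some ht)) (w (Some hq)) (w None)) fF
           (Some ht : withU tq_index)).
Qed.

Lemma heat_partial_q (z : pt plane) l :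
  is_derive (fun s => F (pt_val z (Some ht)) s (pt_val z None)) (pt_val z (Some hq)) l ->
  partial (Some hq) f z = l.
Proof using fF.
  apply (partial_represented open_plane f (fun w => F (w (Some ht)) (w (Some hq)) (w None)) fF
           (Some hq : withU tq_index)).
Qed.

Lemma heat_partial_u (z : pt plane) l :
  is_derive (fun s => F (pt_val z (Some ht)) (pt_val z (Some hq)) s) (pt_val z None) l ->
  partial None f z = l.
Proof using fF.
  apply (partial_represented open_plane f (fun w => F (w (Some ht)) (w (Some hq)) (w None)) fF
           (None : withU tq_index)).
Qed.
End HeatPartials.

(** Both the function and its derivative are slices of extensions, so the statement can be iterated
    with the partial derivative of [f] in place of [f]. *)
Lemma smooth_derive_t (f : pt plane -> R) t q u : smooth f ->
  is_derive (fun s => ext f (tqu s q u)) t (ext (partial (Some ht) f) (tqu t q u)).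
Proof.
  intros Hf.
  pose proof (is_derive_partial (Some ht) f (plane_pt (tqu t q u)) (smooth_ex_partial _ _ _ Hf))
    as H.
  rewrite <- ext_pt in H; revert H; apply is_derive_ext.
  intros s; cbn; rewrite tqu_upd_t; reflexivity.
Qed.

Lemma smooth_derive_q (f : pt plane -> R) t q u : smooth f ->
  is_derive (fun s => ext f (tqu t s u)) q (ext (partial (Some hq) f) (tqu t q u)).
Proof.
  intros Hf.
  pose proof (is_derive_partial (Some hq) f (plane_pt (tqu t q u)) (smooth_ex_partial _ _ _ Hf))
    as H.
  rewrite <- ext_pt in H; revert H; apply is_derive_ext.
  intros s; cbn; rewrite tqu_upd_q; reflexivity.
Qed.

Lemma Derive_eq (f : R -> R) (x l : R) : is_derive f x l -> Derive f x = l.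
Proof. apply is_derive_unique. Qed.

Lemma heat_pr2_apply (v : vfield plane) z p q :
  pr2_apply v heat z p q = pr1 v ht z p + pr2 v hq hq z p q.
Proof.
  apply is_derive_unique; unfold heat.
  auto_derive; [trivial | coord_ring].
Qed.

(** Whatever the coefficients of [v] are, [pr1] is a polynomial in the first derivatives, so its
    [p]-derivatives can be computed outright. The result is affine in the second derivatives, whose
    coefficients can therefore be isolated. *)
Lemma heat_pr2_affine (v : vfield plane) z p q :
  pr2 v hq hq z p q =
    partial (Some hq) (fun y => pr1 v hq y p) z
    + p hq * partial None (fun y => pr1 v hq y p) z
    + q hq hq * (partial None (v None) z - 2 * total0 hq (v (Some hq)) z p
        - p hq * partial None (v (Some hq)) z - p ht * partial None (v (Some ht)) z)
    - 2 * q hq ht * total0 hq (v (Some ht)) z p.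
Proof.
  unfold pr2, total1, isum; cbn.
  rewrite (Derive_eq (fun s => pr1 v hq z (upd p ht s)) (p ht)
    (- total0 hq (v (Some ht)) z p)).
  2:{ unfold pr1, total0, isum, upd; cbn; auto_derive; [trivial | coord_ring]. }
  rewrite (Derive_eq (fun s => pr1 v hq z (upd p hq s)) (p hq)
    (partial None (v None) z - total0 hq (v (Some hq)) z p
      - p hq * partial None (v (Some hq)) z - p ht * partial None (v (Some ht)) z)).
  2:{ unfold pr1, total0, isum, upd; cbn; auto_derive; [trivial | coord_ring]. }
  coord_ring.
Qed.

Section HeatReduced.
Variables (v : vfield plane) (T T1 : R -> R) (Xi Xit Xiq Xiqq La Lat Laq Laqq : R -> R -> R).
Hypotheses
  (v_t : forall z, v (Some ht) z = T (pt_val z (Some ht)))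
  (v_q : forall z, v (Some hq) z = Xi (pt_val z (Some ht)) (pt_val z (Some hq)))
  (v_u : forall z, v None z = La (pt_val z (Some ht)) (pt_val z (Some hq)) * pt_val z None)
  (dT : forall t, is_derive T t (T1 t))
  (dXit : forall t q, is_derive (fun s => Xi s q) t (Xit t q))
  (dXiq : forall t q, is_derive (Xi t) q (Xiq t q))
  (dXiqq : forall t q, is_derive (Xiq t) q (Xiqq t q))
  (dLat : forall t q, is_derive (fun s => La s q) t (Lat t q))
  (dLaq : forall t q, is_derive (La t) q (Laq t q))
  (dLaqq : forall t q, is_derive (Laq t) q (Laqq t q)).

(** Serves in both directions: with slices of an unknown symmetry it produces the determining
    equations, and with explicit formulas it verifies the candidates. *)
Lemma heat_pr2_reduced z p q :
  let t := pt_val z (Some ht) in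
  let x := pt_val z (Some hq) in
  let u := pt_val z None in
  pr2_apply v heat z p q =
    Lat t x * u + p ht * La t x - p hq * Xit t x - p ht * T1 t
    + (Laqq t x * u + 2 * p hq * Laq t x + q hq hq * La t x
       - 2 * q hq hq * Xiq t x - p hq * Xiqq t x).
Proof using All.
  cbv zeta.
  assert (Tt : forall y, partial (Some ht) (v (Some ht)) y = T1 (pt_val y (Some ht)))
    by (intros y; apply (heat_partial_t _ (fun t q u => T t) v_t); apply dT).
  assert (Tq : forall y, partial (Some hq) (v (Some ht)) y = 0)
    by (intros y; apply (heat_partial_q _ (fun t q u => T t) v_t); apply (is_derive_const (T _))).
  assert (Tu : forall y, partial None (v (Some ht)) y = 0)
    by (intros y; apply (heat_partial_u _ (fun t q u => T t) v_t); apply (is_derive_const (T _))).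
  assert (Xt : forall y, partial (Some ht) (v (Some hq)) y
      = Xit (pt_val y (Some ht)) (pt_val y (Some hq)))
    by (intros y; apply (heat_partial_t _ (fun t q u => Xi t q) v_q); apply dXit).
  assert (Xq : forall y, partial (Some hq) (v (Some hq)) y
      = Xiq (pt_val y (Some ht)) (pt_val y (Some hq)))
    by (intros y; apply (heat_partial_q _ (fun t q u => Xi t q) v_q); apply dXiq).
  assert (Xu : forall y, partial None (v (Some hq)) y = 0)
    by (intros y; apply (heat_partial_u _ (fun t q u => Xi t q) v_q);
        apply (is_derive_const (Xi _ _))).
  assert (Ut : forall y, partial (Some ht) (v None) y
      = Lat (pt_val y (Some ht)) (pt_val y (Some hq)) * pt_val y None).
  { intros y; apply (heat_partial_t _ (fun t q u => La t q * u) v_u).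
    apply is_derive_Rmult_const, dLat. }
  assert (Uq : forall y, partial (Some hq) (v None) y
      = Laq (pt_val y (Some ht)) (pt_val y (Some hq)) * pt_val y None).
  { intros y; apply (heat_partial_q _ (fun t q u => La t q * u) v_u).
    apply is_derive_Rmult_const, dLaq. }
  assert (Uu : forall y, partial None (v None) y = La (pt_val y (Some ht)) (pt_val y (Some hq))).
  { intros y; apply (heat_partial_u _ (fun t q u => La t q * u) v_u).
    auto_derive; [trivial | coord_ring]. }
  assert (P1 : forall y, pr1 v hq y p
      = (fun t x u => Laq t x * u + p hq * La t x - p hq * Xiq t x)
          (pt_val y (Some ht)) (pt_val y (Some hq)) (pt_val y None)).
  { intros y; unfold pr1, total0, isum; cbn.
    rewrite Uq, Uu, Tq, Tu, Xq, Xu; coord_ring. }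
  rewrite heat_pr2_apply, heat_pr2_affine.
  rewrite (heat_partial_q _ _ P1 z
    (Laqq (pt_val z (Some ht)) (pt_val z (Some hq)) * pt_val z None
     + p hq * Laq (pt_val z (Some ht)) (pt_val z (Some hq))
     - p hq * Xiqq (pt_val z (Some ht)) (pt_val z (Some hq)))).
  2:{ auto_derive.
      - repeat split; eexists; eauto.
      - rewrite (Derive_eq _ _ _ (dLaqq _ _)), (Derive_eq _ _ _ (dLaq _ _)),
          (Derive_eq _ _ _ (dXiqq _ _)); coord_ring. }
  rewrite (heat_partial_u _ _ P1 z (Laq (pt_val z (Some ht)) (pt_val z (Some hq)))).
  2:{ auto_derive; [trivial | coord_ring]. }
  unfold pr1, total0, isum; cbn.
  rewrite Uu, Xq, Xu, Tu, Tq, Ut, Xt, Tt; coord_ring.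
Qed.
End HeatReduced.

(** Jets for testing the symmetry condition. [u_tt] occurs neither in the equation nor in the
    prolongation coefficients applied to it, and is set to 0. *)
Definition heat_p (pt pq : R) : tq_index -> R :=
  fun i => match i with ht => pt | hq => pq end.
Definition heat_q (qq qm : R) : tq_index -> tq_index -> R :=
  fun i j => match i, j with hq, hq => qq | ht, ht => 0 | _, _ => qm end.

Section HeatSymmetry.
Variable v : vfield plane.
Hypothesis v_sym : is_symmetry heat v.

Lemma heat_symmetry_eq z pq qq qm :
  pr1 v ht z (heat_p (- qq) pq) + pr2 v hq hq z (heat_p (- qq) pq) (heat_q qq qm) = 0.
Proof using v_sym.
  rewrite <- heat_pr2_apply.
  apply v_sym; [intros [] []; reflexivity | unfold heat; cbn; ring].
Qed.

(** This is the coefficient of [u_qt], isolated as the difference of the condition at [u_qt = 1] and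
    at [u_qt = 0]. *)
Lemma heat_tau_total z p : total0 hq (v (Some ht)) z p = 0.
Proof using v_sym.
  pose proof (heat_symmetry_eq z (p hq) 0 0) as H0.
  pose proof (heat_symmetry_eq z (p hq) 0 1) as H1.
  rewrite heat_pr2_affine in H0, H1; cbn in H0, H1.
  change (total0 hq (v (Some ht)) z p)
    with (total0 hq (v (Some ht)) z (heat_p (- 0) (p hq))).
  lra.
Qed.

Lemma heat_tau_q z : partial (Some hq) (v (Some ht)) z = 0.
Proof using v_sym.
  pose proof (heat_tau_total z (heat_p 0 0)) as H; unfold total0 in H; cbn in H; coord_lra.
Qed.

Lemma heat_tau_u z : partial None (v (Some ht)) z = 0.
Proof using v_sym.
  pose proof (heat_tau_total z (heat_p 0 1)) as H; unfold total0 in H; cbn in H.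
  pose proof (heat_tau_q z) as H'; cbn in H'; coord_lra.
Qed.

(** After the substitution u_t = - u_qq the coefficient of [u_qq] is tau_t - 2 (xi_q + u_q xi_u). It
    vanishes for every [u_q], and the values 0 and 1 separate the two parts. *)
Lemma heat_xi_u z : partial None (v (Some hq)) z = 0.
Proof using v_sym.
  (* With tau_q = tau_u = 0 the coefficient [pr1 v hq] no longer contains [u_t], so the substitution
     for [u_t] brings no [u_qq] into it. *)
  assert (P1 : forall pt pq, (fun y => pr1 v hq y (heat_p pt pq))
      = (fun y => pr1 v hq y (heat_p 0 pq))).
  { intros; extensionality y; unfold pr1, isum; cbn.
    rewrite !heat_tau_total; unfold total0; cbn; coord_ring. }
  assert (E : forall pq, partial (Some ht) (v (Some ht)) z
      - 2 * total0 hq (v (Some hq)) z (heat_p 0 pq) = 0).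
  { intros pq.
    pose proof (heat_symmetry_eq z pq 0 0) as H0.
    pose proof (heat_symmetry_eq z pq 1 0) as H1.
    rewrite heat_pr2_affine, heat_tau_total, P1 in H0, H1.
    unfold pr1, total0, isum in *; cbn in *.
    pose proof (heat_tau_u z) as Hu; cbn in Hu; rewrite Hu in *.
    coord_lra. }
  pose proof (E 0) as E0; pose proof (E 1) as E1.
  unfold total0 in E0, E1; cbn in E0, E1; cbn; coord_lra.
Qed.
End HeatSymmetry.

(** * Integration of the determining equations of the heat equation *)

Lemma increment_eq (f g df : R -> R) a b :
  (forall s, is_derive f s (df s)) -> (forall s, is_derive g s (df s)) ->
  f b - f a = g b - g a.
Proof. intros Hf Hg; apply (increment_unique f g df); auto. Qed.

Lemma affine_of_constant_derivative (f : R -> R) c t :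
  (forall s, is_derive f s c) -> f t = f 0 + c * t.
Proof.
  intros Hf.
  pose proof (increment_eq f (fun s => c * s) (fun _ => c) 0 t Hf) as E.
  cbn beta in E; rewrite Rmult_0_r in E; enough (f t - f 0 = c * t - 0) by lra; apply E.
  intros s; auto_derive; [trivial | ring].
Qed.

Lemma quadratic_of_affine_derivative (f : R -> R) c0 c1 t :
  (forall s, is_derive f s (c0 + c1 * s)) -> f t = f 0 + c0 * t + c1 / 2 * t ^ 2.
Proof.
  intros Hf.
  pose proof (increment_eq f (fun s => c0 * s + c1 / 2 * s ^ 2) (fun s => c0 + c1 * s) 0 t Hf)
    as E.
  cbn beta in E.
  enough (f t - f 0 = c0 * t + c1 / 2 * t ^ 2 - (c0 * 0 + c1 / 2 * 0 ^ 2)) by lra; apply E.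
  intros s; auto_derive; [trivial | field].
Qed.

Lemma quadratic_of_third_derivative_zero (T T1 T2 : R -> R) :
  (forall t, is_derive T t (T1 t)) -> (forall t, is_derive T1 t (T2 t)) ->
  (forall t, is_derive T2 t 0) ->
  forall t, T2 t = T2 0 /\ T1 t = T1 0 + T2 0 * t /\ T t = T 0 + T1 0 * t + T2 0 / 2 * t ^ 2.
Proof.
  intros d0 d1 d2.
  assert (E2 : forall t, T2 t = T2 0)
    by (intros t; rewrite (affine_of_constant_derivative T2 0 t d2); ring).
  assert (E1 : forall t, T1 t = T1 0 + T2 0 * t).
  { intros t; apply affine_of_constant_derivative; intros s; rewrite <- (E2 s); apply d1. }
  intros t; split; [apply E2 | split; [apply E1|]].
  apply quadratic_of_affine_derivative; intros s; rewrite <- E1; apply d0.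
Qed.

(** The device for differentiating an identity between an unknown function, whose derivative already
    has a name, and an explicit expression. *)
Lemma is_derive_determined (f g : R -> R) x l m :
  (forall s, f s = g s) -> is_derive f x l -> is_derive g x m -> l = m.
Proof.
  intros E Hf Hg.
  apply (is_derive_ext f g) in Hf; [|exact E].
  rewrite <- (Derive_eq _ _ _ Hf); apply Derive_eq, Hg.
Qed.

Lemma quadratic_zero a b c : (forall q, a * q ^ 2 + b * q + c = 0) -> a = 0 /\ b = 0 /\ c = 0.
Proof.
  intros H; pose proof (H 0); pose proof (H 1); pose proof (H (-1)); lra.
Qed.

(** The equations [e_qq], [e_q], [e_1] are the coefficients of [u_qq], [u_q] and [u]. By the first,
    [Xi] is affine in q with slope [T1 t / 2]; by the second, [La] is quadratic in q; the third is
    then a quadratic polynomial in q, whose three coefficients are differential equations in t. *)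
Lemma heat_solutions (T T1 T2 T3 : R -> R) (Xi Xit Xitt Xiq Xiqq La Lat Laq Laqq : R -> R -> R)
  (dT : forall t, is_derive T t (T1 t))
  (dT1 : forall t, is_derive T1 t (T2 t))
  (dT2 : forall t, is_derive T2 t (T3 t))
  (dXit : forall t q, is_derive (fun s => Xi s q) t (Xit t q))
  (dXitt : forall t q, is_derive (fun s => Xit s q) t (Xitt t q))
  (dXiq : forall t q, is_derive (Xi t) q (Xiq t q))
  (dXiqq : forall t q, is_derive (Xiq t) q (Xiqq t q))
  (dLat : forall t q, is_derive (fun s => La s q) t (Lat t q))
  (dLaq : forall t q, is_derive (La t) q (Laq t q))
  (dLaqq : forall t q, is_derive (Laq t) q (Laqq t q))
  (e_qq : forall t q, T1 t = 2 * Xiq t q)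
  (e_q : forall t q, 2 * Laq t q = Xit t q + Xiqq t q)
  (e_1 : forall t q, Lat t q + Laqq t q = 0) :
  exists mE mF mH mX mY mZ : R, forall t q,
    T t = mE * t ^ 2 + 2 * mH * t - mF /\
    Xi t q = (mE * t + mH) * q - mX * t + mY /\
    La t q = mE * (q ^ 2 / 4 - t / 2) - mH / 2 - mX * q / 2 + mZ / 2.
Proof.
  assert (EXi : forall t q, Xi t q = T1 t / 2 * q + Xi t 0).
  { intros t q; rewrite (affine_of_constant_derivative (Xi t) (T1 t / 2)); [ring|].
    intros s; replace (T1 t / 2) with (Xiq t s) by (rewrite (e_qq t s); field); apply dXiq. }
  assert (EXit : forall t q, Xit t q = T2 t / 2 * q + Xit t 0).
  { intros t q.
    apply (is_derive_determined (fun s => Xi s q) (fun s => T1 s / 2 * q + Xi s 0) t);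
      [intros s; apply EXi | apply dXit|].
    apply is_derive_Rplus; [|apply dXit].
    apply is_derive_Rmult_const, is_derive_Rmult_const, dT1. }
  assert (EXiqq : forall t q, Xiqq t q = 0).
  { intros t q.
    apply (is_derive_determined (Xiq t) (fun _ => T1 t / 2) q);
      [intros s; rewrite (e_qq t s); field | apply dXiqq | apply (is_derive_const (T1 t / 2))]. }
  assert (ELaq : forall t q, Laq t q = Xit t 0 / 2 + T2 t / 4 * q).
  { intros t q; pose proof (e_q t q) as E; rewrite EXiqq, EXit in E; lra. }
  assert (ELa : forall t q, La t q = La t 0 + Xit t 0 / 2 * q + T2 t / 4 / 2 * q ^ 2).
  { intros t q; apply quadratic_of_affine_derivative; intros s; rewrite <- ELaq; apply dLaq. }
  assert (ELat : forall t q, Lat t q = Lat t 0 + Xitt t 0 / 2 * q + T3 t / 4 / 2 * q ^ 2).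
  { intros t q.
    apply (is_derive_determined (fun s => La s q)
             (fun s => La s 0 + Xit s 0 / 2 * q + T2 s / 4 / 2 * q ^ 2) t);
      [intros s; apply ELa | apply dLat|].
    repeat apply is_derive_Rplus; [apply dLat | |];
      repeat apply is_derive_Rmult_const; [apply dXitt | apply dT2]. }
  assert (ELaqq : forall t q, Laqq t q = T2 t / 4).
  { intros t q.
    apply (is_derive_determined (Laq t) (fun s => Xit t 0 / 2 + T2 t / 4 * s) q);
      [intros s; apply ELaq | apply dLaqq | auto_derive; [trivial | ring]]. }
  assert (E0 : forall t, T3 t = 0 /\ Xitt t 0 = 0 /\ Lat t 0 = - T2 t / 4).
  { intros t.
    destruct (quadratic_zero (T3 t / 4 / 2) (Xitt t 0 / 2) (Lat t 0 + T2 t / 4)) as [H2 [H1 H0]].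
    - intros q; pose proof (e_1 t q) as E; rewrite ELat, ELaqq in E; lra.
    - lra. }
  pose proof (quadratic_of_third_derivative_zero T T1 T2 dT dT1) as ET.
  assert (dT2' : forall t, is_derive T2 t 0) by (intros t; rewrite <- (proj1 (E0 t)); apply dT2).
  specialize (ET dT2').
  assert (Es : forall t, Xit t 0 = Xit 0 0).
  { intros t; rewrite (affine_of_constant_derivative (fun s => Xit s 0) 0 t); [ring|].
    intros s; pose proof (dXitt s 0) as d; rewrite (proj1 (proj2 (E0 s))) in d; exact d. }
  assert (Exi : forall t, Xi t 0 = Xi 0 0 + Xit 0 0 * t).
  { intros t; apply (affine_of_constant_derivative (fun s => Xi s 0)).
    intros s; rewrite <- (Es s); apply dXit. }
  assert (Ela : forall t, La t 0 = La 0 0 + - T2 0 / 4 * t).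
  { intros t; apply (affine_of_constant_derivative (fun s => La s 0)).
    intros s; pose proof (dLat s 0) as d.
    rewrite (proj2 (proj2 (E0 s))), (proj1 (ET s)) in d; exact d. }
  (* The constants of integration at t = q = 0, in the normalization of [heat_field]: F is - d_t, X
     is minus the boost, and [La 0 0] equals (mZ - mH) / 2. *)
  exists (T2 0 / 2), (- T 0), (T1 0 / 2), (- Xit 0 0), (Xi 0 0), (2 * La 0 0 + T1 0 / 2).
  intros t q; destruct (ET t) as [E2 [E1 ET0]].
  repeat split.
  - rewrite ET0; field.
  - rewrite EXi, Exi, E1; field.
  - rewrite ELa, Ela, Es, E2; field.
Qed.

(** * The heat symmetries and their parametrization by M *)

Section HeatExtraction.
Variable v : vfield plane.
Hypothesis v_sym : is_linear_symmetry heat v.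

Lemma heat_form :
  exists mE mF mH mX mY mZ : R, forall z : pt plane,
    let t := pt_val z (Some ht) in
    let q := pt_val z (Some hq) in
    v (Some ht) z = mE * t ^ 2 + 2 * mH * t - mF /\
    v (Some hq) z = (mE * t + mH) * q - mX * t + mY /\
    v None z = (mE * (q ^ 2 / 4 - t / 2) - mH / 2 - mX * q / 2 + mZ / 2) * pt_val z None.
Proof using v_sym.
  destruct v_sym as [sym [lambda v_lambda]].
  pose proof (proj1 sym) as sm.
  pose (T := fun (f : pt plane -> R) t => ext f (tqu t 0 0)).
  (* The slice u = 0 is used for xi, which does not depend on u. The slice u = 1 of phi = lambda u
     is lambda itself, which thereby inherits smoothness from phi. *)
  pose (F := fun (c : R) (f : pt plane -> R) t q => ext f (tqu t q c)).
  pose (tau := v (Some ht)); pose (xi := v (Some hq)); pose (phi := v None).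
  pose (dt := partial (D := plane) (Some ht)); pose (dq := partial (D := plane) (Some hq)).
  assert (sm_tau : smooth tau) by apply sm.
  assert (sm_xi : smooth xi) by apply sm.
  assert (sm_phi : smooth phi) by apply sm.
  assert (dF_t : forall c f, smooth f ->
    forall t q, is_derive (fun s => F c f s q) t (F c (dt f) t q))
    by (intros; apply smooth_derive_t; assumption).
  assert (dF_q : forall c f, smooth f -> forall t q, is_derive (F c f t) q (F c (dq f) t q))
    by (intros; apply smooth_derive_q; assumption).
  assert (dT : forall f, smooth f -> forall t, is_derive (T f) t (T (dt f) t))
    by (intros; apply smooth_derive_t; assumption).
  assert (sm_t : forall f, smooth f -> smooth (dt f)) by (intros; apply smooth_partial; auto).
  assert (sm_q : forall f, smooth f -> smooth (dq f)) by (intros; apply smooth_partial; auto).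
  assert (indep_u : forall (f : pt plane -> R) z s, smooth f -> (forall y, partial None f y = 0) ->
    ext f z = ext f (tqu (z (Some ht)) (z (Some hq)) s)).
  { intros f z s Hf H0; rewrite <- (tqu_upd_u _ _ (z None)), <- tqu_eta; symmetry.
    apply constant_of_partial_zero; auto; intros; exact I. }
  assert (v_t : forall z : pt plane, tau z = T tau (pt_val z (Some ht))).
  { intros z; rewrite <- ext_pt, (indep_u tau _ 0 (sm _)) by apply heat_tau_u, sym.
    unfold T; rewrite <- (tqu_upd_q _ (pt_val z (Some hq)) _ 0); symmetry.
    apply constant_of_partial_zero; [intros; exact I | apply sm | apply heat_tau_q, sym]. }
  assert (v_q : forall z : pt plane, xi z = F 0 xi (pt_val z (Some ht)) (pt_val z (Some hq)))
    by (intros z; rewrite <- ext_pt; apply indep_u; [apply sm | apply heat_xi_u, sym]).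
  assert (v_u : forall z : pt plane, phi z
      = F 1 phi (pt_val z (Some ht)) (pt_val z (Some hq)) * pt_val z None).
  { intros z; unfold phi, F; rewrite (ext_in _ _ (I : plane (tqu _ _ 1))), !v_lambda; cbn.
    rewrite Rmult_1_r; f_equal; f_equal; extensionality i; destruct i; reflexivity. }
  assert (E : forall t q u P Q,
    F 1 (dt phi) t q * u - Q * F 1 phi t q - P * F 0 (dt xi) t q + Q * T (dt tau) t
    + (F 1 (dq (dq phi)) t q * u + 2 * P * F 1 (dq phi) t q + Q * F 1 phi t q
       - 2 * Q * F 0 (dq xi) t q - P * F 0 (dq (dq xi)) t q) = 0).
  { intros t q u P Q.
    pose proof (heat_pr2_reduced v (T tau) (T (dt tau)) (F 0 xi) (F 0 (dt xi)) (F 0 (dq xi))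
      (F 0 (dq (dq xi))) (F 1 phi) (F 1 (dt phi)) (F 1 (dq phi)) (F 1 (dq (dq phi)))
      v_t v_q v_u (dT _ (sm _)) (dF_t _ _ (sm _)) (dF_q _ _ (sm _)) (dF_q _ _ (sm_q _ (sm _)))
      (dF_t _ _ (sm _)) (dF_q _ _ (sm _)) (dF_q _ _ (sm_q _ (sm _)))
      (plane_pt (tqu t q u)) (heat_p (- Q) P) (heat_q Q 0)) as H.
    rewrite (proj2 sym) in H;
      [| intros [] []; reflexivity | unfold heat; cbn; ring].
    cbn in H; etransitivity; [| symmetry; exact H]; coord_ring. }
  destruct (heat_solutions (T tau) (T (dt tau)) (T (dt (dt tau))) (T (dt (dt (dt tau))))
    (F 0 xi) (F 0 (dt xi)) (F 0 (dt (dt xi))) (F 0 (dq xi)) (F 0 (dq (dq xi)))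
    (F 1 phi) (F 1 (dt phi)) (F 1 (dq phi)) (F 1 (dq (dq phi))))
    as [mE [mF [mH [mX [mY [mZ H]]]]]];
    [solve [auto 8] .. | | | |].
  (* A jet with a single free entry equal to 1 reads off one coefficient: that of [u_qq], then of
     [u_q], then of [u]. *)
  - intros t q; pose proof (E t q 0 0 1); lra.
  - intros t q; pose proof (E t q 0 1 0); lra.
  - intros t q; pose proof (E t q 1 0 0); lra.
  - exists mE, mF, mH, mX, mY, mZ; intros z t q.
    destruct (H t q) as [H1 [H2 H3]].
    rewrite <- H1, <- H2, <- H3; auto.
Qed.
End HeatExtraction.

(** E, F, H act on t by projective transformations, X is a Galilean boost and Y a translation. The
    sign of F makes [E,F] = H hold with H = 2 t d_t + q d_q - (u/2) d_u, and [X,Y] = Z forces Z =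
    (u/2) d_u. *)
Definition heat_field (m : calM) : vspace plane := fun k z =>
  let t := pt_val z (Some ht) in
  let q := pt_val z (Some hq) in
  match k with
  | Some ht => m gE * t ^ 2 + 2 * m gH * t - m gF
  | Some hq => (m gE * t + m gH) * q - m gX * t + m gY
  | None => (m gE * (q ^ 2 / 4 - t / 2) - m gH / 2 - m gX * q / 2 + m gZ / 2) * pt_val z None
  end.

Lemma heat_field_symmetry m : calH00 (heat_field m).
Proof.
  split; [split|].
  - intros [[]|]; cbn; smooth_tac open_plane fail.
  - intros z p q _ Hpq.
    rewrite (heat_pr2_reduced (heat_field m)
      (fun t => m gE * t ^ 2 + 2 * m gH * t - m gF)
      (fun t => 2 * m gE * t + 2 * m gH)
      (fun t q => (m gE * t + m gH) * q - m gX * t + m gY)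
      (fun t q => m gE * q - m gX)
      (fun t q => m gE * t + m gH)
      (fun t q => 0)
      (fun t q => m gE * (q ^ 2 / 4 - t / 2) - m gH / 2 - m gX * q / 2 + m gZ / 2)
      (fun t q => - m gE / 2)
      (fun t q => m gE * q / 2 - m gX / 2)
      (fun t q => m gE / 2));
      try (intros; auto_derive; [trivial | field]); try reflexivity.
    unfold heat in Hpq; cbn in Hpq.
    replace (p ht) with (- q hq hq) by coord_lra; cbn; field.
  - exists (fun w => m gE * (w hq ^ 2 / 4 - w ht / 2) - m gH / 2 - m gX * w hq / 2 + m gZ / 2).
    reflexivity.
Qed.

Lemma heat_field_surj w : calH00 w -> exists m, heat_field m = w.
Proof.
  intros Hw; destruct (heat_form w Hw) as [mE [mF [mH [mX [mY [mZ H]]]]]].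
  exists (fun g => match g with gE => mE | gF => mF | gH => mH | gX => mX | gY => mY
    | gZ => mZ end).
  extensionality k; extensionality z; destruct (H z) as [H1 [H2 H3]].
  destruct k as [[]|]; symmetry; assumption.
Qed.

Lemma heat_field_inj m n : heat_field m = heat_field n -> m = n.
Proof.
  intros E.
  assert (H : forall k t q, heat_field m k (plane_pt (tqu t q 1))
    = heat_field n k (plane_pt (tqu t q 1))) by (rewrite E; reflexivity).
  pose proof (H (Some ht) 0 0); pose proof (H (Some ht) 1 0); pose proof (H (Some ht) (-1) 0).
  pose proof (H (Some hq) 0 0); pose proof (H (Some hq) 1 0); pose proof (H None 0 0).
  cbn in *; extensionality g; destruct g; lra.
Qed.

Lemma heat_field_bracket m n :
  heat_field (mbracket m n) = vbracket (heat_field m) (heat_field n).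
Proof.
  extensionality k; extensionality z.
  pose (c := fun (m : calM) (k : withU tq_index) t q u => match k with
    | Some ht => m gE * t ^ 2 + 2 * m gH * t - m gF
    | Some hq => (m gE * t + m gH) * q - m gX * t + m gY
    | None => (m gE * (q ^ 2 / 4 - t / 2) - m gH / 2 - m gX * q / 2 + m gZ / 2) * u
    end).
  (* [cd m j k] is the derivative along [j] of the coefficient [c m k]; with this table the bracket
     becomes a polynomial identity. *)
  pose (cd := fun (m : calM) (j k : withU tq_index) t q u => match j, k with
    | Some ht, Some ht => 2 * m gE * t + 2 * m gH
    | Some ht, Some hq => m gE * q - m gX
    | Some hq, Some hq => m gE * t + m gH
    | Some ht, None => - m gE / 2 * u
    | Some hq, None => (m gE * q / 2 - m gX / 2) * u
    | None, None => m gE * (q ^ 2 / 4 - t / 2) - m gH / 2 - m gX * q / 2 + m gZ / 2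
    | _, _ => 0
    end).
  assert (P : forall m j k, partial j (heat_field m k) z
    = cd m j k (pt_val z (Some ht)) (pt_val z (Some hq)) (pt_val z None)).
  { clear m n k; intros m [[]|] k.
    - apply (heat_partial_t _ (c m k)); destruct k as [[]|]; cbn; try reflexivity;
        auto_derive; trivial; field.
    - apply (heat_partial_q _ (c m k)); destruct k as [[]|]; cbn; try reflexivity;
        auto_derive; trivial; field.
    - apply (heat_partial_u _ (c m k)); destruct k as [[]|]; cbn; try reflexivity;
        auto_derive; trivial; field. }
  unfold vbracket, isum; cbn [idx_enum withU tq_index map fold_right]; rewrite !P.
  destruct k as [[]|]; cbn; field.
Qed.

Lemma calH00_model :
  is_lie_algebra calH00 vbracket /\ lie_isomorphic calH00 vbracket allM mbracket /\
  lie_isomorphic allM mbracket calH00 vbracket.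
Proof.
  apply (lie_model calH00 vbracket heat_field);
    auto using heat_field_symmetry, heat_field_surj, heat_field_inj, heat_field_bracket.
  - intros m n; extensionality k; extensionality z; destruct k as [[]|]; cbn; field.
  - intros c m; extensionality k; extensionality z; destruct k as [[]|]; cbn; field.
Qed.

(** * The determining equations of the two-dimensional equation *)

(** The origin lies on the boundary of the half-line, so integration starts at 1, where the square
    root is 1. *)
Lemma increment_from_1 (f g df : R -> R) x : 0 < x ->
  (forall s, 0 < s -> is_derive f s (df s)) -> (forall s, 0 < s -> is_derive g s (df s)) ->
  f x = f 1 + (g x - g 1).
Proof.
  intros Hx Hf Hg; enough (f x - f 1 = g x - g 1) by lra.
  assert (H : forall s, Rmin 1 x <= s -> 0 < s).
  { intros s; apply Rlt_le_trans, Rmin_glb_lt; lra. }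
  apply (increment_unique f g df); intros s [Hs _]; auto.
Qed.

Lemma is_derive_determined_pos (f g : R -> R) x l m : 0 < x ->
  (forall s, 0 < s -> f s = g s) -> is_derive f x l -> is_derive g x m -> l = m.
Proof.
  intros Hx E Hf Hg.
  apply (is_derive_ext_loc f g) in Hf.
  - rewrite <- (Derive_eq _ _ _ Hf); apply Derive_eq, Hg.
  - exists (mkposreal x Hx); intros s Hs; apply E.
    apply Rabs_def2 in Hs; unfold minus, plus, opp in Hs; cbn in Hs; lra.
Qed.

Lemma sqrt_pos_square x : 0 < x -> 0 < sqrt x /\ x = sqrt x * sqrt x.
Proof.
  intros Hx; split; [apply sqrt_lt_R0, Hx | rewrite sqrt_sqrt; lra].
Qed.

(* [(f s / sqrt s - c * sqrt s)' = 0] *)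
Lemma half_euler_solution (f f' : R -> R) c x : 0 < x ->
  (forall s, 0 < s -> is_derive f s (f' s)) ->
  (forall s, 0 < s -> f s = 2 * s * f' s - s * c) ->
  f x = c * x + sqrt x * (f 1 - c).
Proof.
  intros Hx Hf E.
  pose proof (increment_from_1 (fun s => f s / sqrt s - c * sqrt s) (fun _ => 0) (fun _ => 0) x
    Hx) as H; cbn beta in H.
  rewrite sqrt_1 in H.
  destruct (sqrt_pos_square x Hx) as [Hs Hxx].
  assert (H' : f x / sqrt x - c * sqrt x = f 1 / 1 - c * 1).
  { rewrite H; [ring | | intros s _; apply (is_derive_const 0)].
    intros s Ps; destruct (sqrt_pos_square s Ps) as [Hs' Hss].
    auto_derive.
    - repeat split; try lra; eexists; apply Hf, Ps.
    - assert (Ed : Derive (fun w => f w) s = f' s) by apply Derive_eq, Hf, Ps.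
      rewrite Ed, (E s Ps).
      set (r := sqrt s) in *; rewrite Hss; field; lra. }
  replace (f x) with (sqrt x * (f x / sqrt x - c * sqrt x) + c * (sqrt x * sqrt x))
    by (field; lra).
  rewrite H', <- Hxx; field.
Qed.

(** Only the derivatives that occur in the determining equations are recorded. Mixed ones are
    absent; compatibility conditions are obtained by integrating in one variable and differentiating
    in another. *)
Record jet (f fx fxx fy fyy ft : R -> R -> R -> R) : Prop := {
  jet_x : forall x y t, 0 < x -> 0 < y -> is_derive (fun s => f s y t) x (fx x y t);
  jet_xx : forall x y t, 0 < x -> 0 < y -> is_derive (fun s => fx s y t) x (fxx x y t);
  jet_y : forall x y t, 0 < x -> 0 < y -> is_derive (fun s => f x s t) y (fy x y t);
  jet_yy : forall x y t, 0 < x -> 0 < y -> is_derive (fun s => fy x s t) y (fyy x y t);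
  jet_t : forall x y t, 0 < x -> 0 < y -> is_derive (fun s => f x y s) t (ft x y t) }.

(** * Integration of the determining equations on the quadrant *)

Section QuadrantSolutions.
Variables (d : R) (T T1 T2 T3 : R -> R)
  (Xi Xix Xixx Xiy Xiyy Xit Xitt Ga Gax Gaxx Gay Gayy Gat Gatt
   La Lax Laxx Lay Layy Lat : R -> R -> R -> R).
Hypotheses
  (dT : forall t, is_derive T t (T1 t))
  (dT1 : forall t, is_derive T1 t (T2 t))
  (dT2 : forall t, is_derive T2 t (T3 t))
  (jXi : jet Xi Xix Xixx Xiy Xiyy Xit)
  (jGa : jet Ga Gax Gaxx Gay Gayy Gat)
  (jLa : jet La Lax Laxx Lay Layy Lat)
  (dXitt : forall x y t, 0 < x -> 0 < y -> is_derive (fun s => Xit x y s) t (Xitt x y t))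
  (dGatt : forall x y t, 0 < x -> 0 < y -> is_derive (fun s => Gat x y s) t (Gatt x y t))
  (e_xx : forall x y t, 0 < x -> 0 < y -> Xi x y t = 2 * x * Xix x y t - x * T1 t)
  (e_yy : forall x y t, 0 < x -> 0 < y -> Ga x y t = 2 * y * Gay x y t - y * T1 t)
  (e_xy : forall x y t, 0 < x -> 0 < y -> x * Gax x y t + y * Xiy x y t = 0)
  (e_x : forall x y t, 0 < x -> 0 < y ->
    x * Lax x y t = Xix x y t / 4 + d * Xiy x y t + x / 2 * Xixx x y t + y / 2 * Xiyy x y t
      + Xit x y t - T1 t / 4)
  (e_y : forall x y t, 0 < x -> 0 < y ->
    y * Lay x y t = Gax x y t / 4 + d * Gay x y t + x / 2 * Gaxx x y t + y / 2 * Gayy x y t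
      + Gat x y t - d * T1 t)
  (e_1 : forall x y t, 0 < x -> 0 < y ->
    Lax x y t / 4 + d * Lay x y t + x / 2 * Laxx x y t + y / 2 * Layy x y t + Lat x y t = 0).

(* The coefficients of the rotation [sqrt (x y) (d_x - d_y)] and of the translations
   [sqrt x d_x], [sqrt y d_y], as functions of [t]. *)
Let k t := (Xi 1 4 t - Xi 1 1 t) / 2.
Let al t := Xi 1 1 t - T1 t - 2 * k t.
Let be t := Ga 1 1 t - T1 t + 2 * k t.
Let k1 t := (Xit 1 4 t - Xit 1 1 t) / 2.
Let al1 t := Xit 1 1 t - T2 t - 2 * k1 t.
Let be1 t := Gat 1 1 t - T2 t + 2 * k1 t.

Lemma dk t : is_derive k t (k1 t).
Proof using jXi.
  unfold k, k1; apply is_derive_Rmult_const.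
  apply (is_derive_minus (fun s => Xi 1 4 s) (fun s => Xi 1 1 s)); apply (jet_t _ _ _ _ _ _ jXi);
    lra.
Qed.

Lemma dal t : is_derive al t (al1 t).
Proof using jXi dT1.
  unfold al, al1.
  apply (is_derive_minus (fun s => Xi 1 1 s - T1 s) (fun s => 2 * k s)).
  - apply (is_derive_minus (fun s => Xi 1 1 s) T1);
      [apply (jet_t _ _ _ _ _ _ jXi); lra | apply dT1].
  - apply (is_derive_scal k), dk.
Qed.

Lemma dbe t : is_derive be t (be1 t).
Proof using jXi jGa dT1.
  unfold be, be1; apply is_derive_Rplus.
  - apply (is_derive_minus (fun s => Ga 1 1 s) T1);
      [apply (jet_t _ _ _ _ _ _ jGa); lra | apply dT1].
  - apply (is_derive_scal k), dk.
Qed.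

(** [e_xx], the coefficient of [u_xx], is a linear first order equation in x for fixed y and t, so
    [Xi] is determined by its values on the side x = 1. *)
Lemma Xi_from_side x y t : 0 < x -> 0 < y -> Xi x y t = T1 t * x + sqrt x * (Xi 1 y t - T1 t).
Proof using jXi e_xx.
  intros Hx Hy; apply (half_euler_solution (fun s => Xi s y t) (fun s => Xix s y t)); auto.
  intros s Hs; apply (jet_x _ _ _ _ _ _ jXi); auto.
Qed.

Lemma Ga_from_side x y t : 0 < x -> 0 < y -> Ga x y t = T1 t * y + sqrt y * (Ga x 1 t - T1 t).
Proof using jGa e_yy.
  intros Hx Hy; apply (half_euler_solution (fun s => Ga x s t) (fun s => Gay x s t)); auto.
  intros s Hs; apply (jet_y _ _ _ _ _ _ jGa); auto.
Qed.

Lemma Xiy_from_side x y t : 0 < x -> 0 < y -> Xiy x y t = Xiy 1 y t * sqrt x.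
Proof using jXi e_xx.
  intros Hx Hy.
  apply (is_derive_determined_pos (fun s => Xi x s t)
    (fun s => (Xi 1 s t - T1 t) * sqrt x + T1 t * x) y); auto.
  - intros s Hs; rewrite Xi_from_side by auto; ring.
  - apply (jet_y _ _ _ _ _ _ jXi); auto.
  - rewrite <- (Rplus_0_r (Xiy 1 y t * sqrt x)).
    apply is_derive_Rplus; [apply is_derive_Rmult_const | apply (is_derive_const (T1 t * x))].
    rewrite <- (Rplus_0_r (Xiy 1 y t)).
    apply is_derive_Rplus; [apply (jet_y _ _ _ _ _ _ jXi); lra | apply (is_derive_const (- T1 t))].
Qed.

Lemma Gax_from_side x y t : 0 < x -> 0 < y -> Gax x y t = Gax x 1 t * sqrt y.
Proof using jGa e_yy.
  intros Hx Hy.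
  apply (is_derive_determined_pos (fun s => Ga s y t)
    (fun s => (Ga s 1 t - T1 t) * sqrt y + T1 t * y) x); auto.
  - intros s Hs; rewrite Ga_from_side by auto; ring.
  - apply (jet_x _ _ _ _ _ _ jGa); auto.
  - rewrite <- (Rplus_0_r (Gax x 1 t * sqrt y)).
    apply is_derive_Rplus; [apply is_derive_Rmult_const | apply (is_derive_const (T1 t * y))].
    rewrite <- (Rplus_0_r (Gax x 1 t)).
    apply is_derive_Rplus; [apply (jet_x _ _ _ _ _ _ jGa); lra | apply (is_derive_const (- T1 t))].
Qed.

(** Separation of variables: in terms of the sides, [e_xy] says that sqrt x Gax(x, 1) equals - sqrt
    y Xiy(1, y) for all x and y, so both are constant in x and y. *)
Lemma sides_derivatives x t : 0 < x ->
  Gax x 1 t = - Xiy 1 1 t / sqrt x /\ Xiy 1 x t = Xiy 1 1 t / sqrt x.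
Proof using jXi jGa e_xx e_yy e_xy.
  intros Hx; destruct (sqrt_pos_square x Hx) as [Hs Hxx].
  assert (H : forall y, 0 < y -> x * (Gax x 1 t * sqrt y) + y * (Xiy 1 y t * sqrt x) = 0).
  { intros y Hy; rewrite <- Gax_from_side, <- Xiy_from_side by auto; apply e_xy; auto. }
  pose proof (H 1 Rlt_0_1) as H1; rewrite sqrt_1 in H1.
  pose proof (e_xy 1 1 t Rlt_0_1 Rlt_0_1) as H11.
  pose proof (e_xy 1 x t Rlt_0_1 Hx) as H1x; rewrite Gax_from_side in H1x by lra.
  split.
  - apply (Rmult_eq_reg_l x); [|lra].
    replace (x * (- Xiy 1 1 t / sqrt x)) with (- Xiy 1 1 t * sqrt x)
      by (rewrite Hxx at 2; field; lra).
    lra.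
  - apply (Rmult_eq_reg_l x); [|lra].
    replace (x * (Xiy 1 1 t / sqrt x)) with (Xiy 1 1 t * sqrt x)
      by (rewrite Hxx at 2; field; lra).
    replace (Gax 1 1 t) with (- Xiy 1 1 t) in H1x by lra; lra.
Qed.

Lemma sqrt_4 : sqrt 4 = 2.
Proof. replace 4 with (2 * 2) by ring; apply sqrt_square; lra. Qed.

Lemma Xi_side y t : 0 < y -> Xi 1 y t = Xi 1 1 t + Xiy 1 1 t * (2 * sqrt y - 2).
Proof using jXi jGa e_xx e_yy e_xy.
  intros Hy.
  rewrite (increment_from_1 (fun s => Xi 1 s t) (fun s => Xiy 1 1 t * (2 * sqrt s))
    (fun s => Xiy 1 s t) y Hy).
  - rewrite sqrt_1; ring.
  - intros s Hs; apply (jet_y _ _ _ _ _ _ jXi); lra.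
  - intros s Hs; pose proof (sqrt_lt_R0 s Hs).
    rewrite (proj2 (sides_derivatives s t Hs)).
    auto_derive; [exact Hs | field; lra].
Qed.

(** Between y = 1 and y = 4 the root grows by exactly 1, and [Xi 1 y t] by 2 [Xiy 1 1 t]; hence the
    points and the factor 1/2 in [k]. *)
Lemma Xiy_11 t : Xiy 1 1 t = k t.
Proof using jXi jGa e_xx e_yy e_xy.
  unfold k; rewrite (Xi_side 4), sqrt_4 by lra; field.
Qed.

Lemma Ga_side x t : 0 < x -> Ga x 1 t = Ga 1 1 t - k t * (2 * sqrt x - 2).
Proof using jXi jGa e_xx e_yy e_xy.
  intros Hx.
  rewrite (increment_from_1 (fun s => Ga s 1 t) (fun s => - k t * (2 * sqrt s))
    (fun s => Gax s 1 t) x Hx).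
  - rewrite sqrt_1; ring.
  - intros s Hs; apply (jet_x _ _ _ _ _ _ jGa); lra.
  - intros s Hs; pose proof (sqrt_lt_R0 s Hs).
    rewrite (proj1 (sides_derivatives s t Hs)), Xiy_11.
    auto_derive; [exact Hs | field; lra].
Qed.

Lemma Xi_form x y t : 0 < x -> 0 < y ->
  Xi x y t = T1 t * x + (al t + 2 * k t * sqrt y) * sqrt x.
Proof using jXi jGa e_xx e_yy e_xy.
  intros Hx Hy; rewrite Xi_from_side, Xi_side, Xiy_11 by auto; unfold al; ring.
Qed.

Lemma Ga_form x y t : 0 < x -> 0 < y ->
  Ga x y t = T1 t * y + (be t - 2 * k t * sqrt x) * sqrt y.
Proof using jXi jGa e_xx e_yy e_xy.
  intros Hx Hy; rewrite Ga_from_side, Ga_side by auto; unfold be; ring.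
Qed.

Lemma Xix_form x y t : 0 < x -> 0 < y ->
  Xix x y t = T1 t + (al t + 2 * k t * sqrt y) / (2 * sqrt x).
Proof using jXi jGa e_xx e_yy e_xy.
  intros Hx Hy; pose proof (sqrt_lt_R0 x Hx).
  eapply (is_derive_determined_pos (fun s => Xi s y t)); [exact Hx | | |].
  - intros s Hs; apply Xi_form; auto.
  - apply (jet_x _ _ _ _ _ _ jXi); auto.
  - auto_derive; [exact Hx | field; lra].
Qed.

Lemma Xixx_form x y t : 0 < x -> 0 < y ->
  Xixx x y t = - (al t + 2 * k t * sqrt y) / (4 * sqrt x ^ 3).
Proof using jXi jGa e_xx e_yy e_xy.
  intros Hx Hy; pose proof (sqrt_lt_R0 x Hx).
  eapply (is_derive_determined_pos (fun s => Xix s y t)); [exact Hx | | |].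
  - intros s Hs; apply Xix_form; auto.
  - apply (jet_xx _ _ _ _ _ _ jXi); auto.
  - auto_derive; [repeat split; try lra | field; lra].
Qed.

Lemma Xiy_form x y t : 0 < x -> 0 < y -> Xiy x y t = k t * sqrt x / sqrt y.
Proof using jXi jGa e_xx e_yy e_xy.
  intros Hx Hy; pose proof (sqrt_lt_R0 y Hy).
  rewrite Xiy_from_side, (proj2 (sides_derivatives y t Hy)), Xiy_11 by auto; field; lra.
Qed.

Lemma Xiyy_form x y t : 0 < x -> 0 < y -> Xiyy x y t = - k t * sqrt x / (2 * sqrt y ^ 3).
Proof using jXi jGa e_xx e_yy e_xy.
  intros Hx Hy; pose proof (sqrt_lt_R0 y Hy).
  eapply (is_derive_determined_pos (fun s => Xiy x s t)); [exact Hy | | |].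
  - intros s Hs; apply Xiy_form; auto.
  - apply (jet_yy _ _ _ _ _ _ jXi); auto.
  - auto_derive; [repeat split; try lra | field; lra].
Qed.

Lemma Xit_form x y t : 0 < x -> 0 < y ->
  Xit x y t = T2 t * x + (al1 t + 2 * k1 t * sqrt y) * sqrt x.
Proof using jXi jGa e_xx e_yy e_xy dT1.
  intros Hx Hy.
  eapply (is_derive_determined (fun s => Xi x y s)).
  - intros s; apply Xi_form; auto.
  - apply (jet_t _ _ _ _ _ _ jXi); auto.
  - apply is_derive_Rplus; apply is_derive_Rmult_const; [apply dT1|].
    apply is_derive_Rplus; [apply dal | apply is_derive_Rmult_const].
    apply (is_derive_scal k), dk.
Qed.

Lemma Gax_form x y t : 0 < x -> 0 < y -> Gax x y t = - k t * sqrt y / sqrt x.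
Proof using jXi jGa e_xx e_yy e_xy.
  intros Hx Hy; pose proof (sqrt_lt_R0 x Hx).
  rewrite Gax_from_side, (proj1 (sides_derivatives x t Hx)), Xiy_11 by auto; field; lra.
Qed.

Lemma Gaxx_form x y t : 0 < x -> 0 < y -> Gaxx x y t = k t * sqrt y / (2 * sqrt x ^ 3).
Proof using jXi jGa e_xx e_yy e_xy.
  intros Hx Hy; pose proof (sqrt_lt_R0 x Hx).
  eapply (is_derive_determined_pos (fun s => Gax s y t)); [exact Hx | | |].
  - intros s Hs; apply Gax_form; auto.
  - apply (jet_xx _ _ _ _ _ _ jGa); auto.
  - auto_derive; [repeat split; try lra | field; lra].
Qed.

Lemma Gay_form x y t : 0 < x -> 0 < y ->
  Gay x y t = T1 t + (be t - 2 * k t * sqrt x) / (2 * sqrt y).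
Proof using jXi jGa e_xx e_yy e_xy.
  intros Hx Hy; pose proof (sqrt_lt_R0 y Hy).
  eapply (is_derive_determined_pos (fun s => Ga x s t)); [exact Hy | | |].
  - intros s Hs; apply Ga_form; auto.
  - apply (jet_y _ _ _ _ _ _ jGa); auto.
  - auto_derive; [exact Hy | field; lra].
Qed.

Lemma Gayy_form x y t : 0 < x -> 0 < y ->
  Gayy x y t = - (be t - 2 * k t * sqrt x) / (4 * sqrt y ^ 3).
Proof using jXi jGa e_xx e_yy e_xy.
  intros Hx Hy; pose proof (sqrt_lt_R0 y Hy).
  eapply (is_derive_determined_pos (fun s => Gay x s t)); [exact Hy | | |].
  - intros s Hs; apply Gay_form; auto.
  - apply (jet_yy _ _ _ _ _ _ jGa); auto.
  - auto_derive; [repeat split; try lra | field; lra].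
Qed.

Lemma Gat_form x y t : 0 < x -> 0 < y ->
  Gat x y t = T2 t * y + (be1 t - 2 * k1 t * sqrt x) * sqrt y.
Proof using jXi jGa e_xx e_yy e_xy dT1.
  intros Hx Hy.
  eapply (is_derive_determined (fun s => Ga x y s)).
  - intros s; apply Ga_form; auto.
  - apply (jet_t _ _ _ _ _ _ jGa); auto.
  - apply is_derive_Rplus; apply is_derive_Rmult_const; [apply dT1|].
    apply (is_derive_minus be (fun s => 2 * k s * sqrt x));
      [apply dbe | apply is_derive_Rmult_const].
    apply (is_derive_scal k), dk.
Qed.

(** Xix / 4 and x Xixx / 2 contribute opposite multiples of 1 / sqrt x, because a = 1/4. The
    remaining pair d Xiy and y Xiyy / 2 leaves the factor d - 1/4, as does the corresponding pair d
    Gay and y Gayy / 2 in [Lay_form]. *)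
Lemma Lax_form x y t : 0 < x -> 0 < y ->
  Lax x y t = T2 t + (al1 t + 2 * k1 t * sqrt y) / sqrt x
    + k t * (d - 1 / 4) / (sqrt x * sqrt y).
Proof using jXi jGa e_xx e_yy e_xy e_x dT1.
  intros Hx Hy; apply (Rmult_eq_reg_l x); [|lra].
  rewrite e_x, Xix_form, Xixx_form, Xiy_form, Xiyy_form, Xit_form by auto.
  destruct (sqrt_pos_square x Hx) as [Hr Hxx], (sqrt_pos_square y Hy) as [Hs Hyy].
  set (r := sqrt x) in *; set (s := sqrt y) in *; rewrite Hxx, Hyy; field; lra.
Qed.

Lemma Lay_form x y t : 0 < x -> 0 < y ->
  Lay x y t = T2 t + (be1 t - 2 * k1 t * sqrt x) / sqrt y
    + (d - 1 / 4) * (be t - 2 * k t * sqrt x) / (2 * sqrt y ^ 3).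
Proof using jXi jGa e_xx e_yy e_xy e_y dT1.
  intros Hx Hy; apply (Rmult_eq_reg_l y); [|lra].
  rewrite e_y, Gay_form, Gayy_form, Gax_form, Gaxx_form, Gat_form by auto.
  destruct (sqrt_pos_square x Hx) as [Hr Hxx], (sqrt_pos_square y Hy) as [Hs Hyy].
  set (r := sqrt x) in *; set (s := sqrt y) in *; rewrite Hxx, Hyy; field; lra.
Qed.

(** The integral of [Lax] from x = 1. Differentiating it in y gives a second expression for [Lay],
    to be compared with the one from [e_y]. *)
Lemma La_from_side x y t : 0 < x -> 0 < y ->
  La x y t = La 1 y t + (T2 t * (x - 1) + 2 * (al1 t + 2 * k1 t * sqrt y) * (sqrt x - 1)
    + 2 * k t * (d - 1 / 4) * (sqrt x - 1) / sqrt y).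
Proof using jXi jGa jLa e_xx e_yy e_xy e_x dT1.
  intros Hx Hy; pose proof (sqrt_lt_R0 y Hy).
  rewrite (increment_from_1 (fun s => La s y t)
    (fun s => T2 t * s + 2 * (al1 t + 2 * k1 t * sqrt y) * sqrt s
      + 2 * k t * (d - 1 / 4) * sqrt s / sqrt y) (fun s => Lax s y t) x Hx).
  - rewrite sqrt_1; field; lra.
  - intros s Hs; apply (jet_x _ _ _ _ _ _ jLa); auto.
  - intros s Hs; pose proof (sqrt_lt_R0 s Hs); rewrite Lax_form by auto.
    auto_derive; [repeat split; lra | field; lra].
Qed.

(* The two expressions of [La_y] at [(4, 1)] differ by [4 k']. *)
Lemma k1_zero t : k1 t = 0.
Proof using jXi jGa jLa e_xx e_yy e_xy e_x e_y dT1.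
  assert (H : Lay 4 1 t = Lay 1 1 t + (2 * k1 t - k t * (d - 1 / 4))).
  { eapply (is_derive_determined_pos (fun s => La 4 s t)); [exact Rlt_0_1 | | |].
    - intros s Hs; apply La_from_side; lra.
    - apply (jet_y _ _ _ _ _ _ jLa); lra.
    - apply is_derive_Rplus; [apply (jet_y _ _ _ _ _ _ jLa); lra|].
      rewrite sqrt_4; auto_derive; rewrite sqrt_1; [repeat split; lra | field]. }
  rewrite !Lay_form, sqrt_4, sqrt_1 in H by lra; lra.
Qed.

(** Arranged as a sum of functions of t times functions of x and y, so that differentiation in t
    proceeds term by term. *)
Lemma La_form x y t : 0 < x -> 0 < y ->
  La x y t = La 1 1 t + T2 t * (x + y - 2) + al1 t * (2 * (sqrt x - 1))
    + be1 t * (2 * (sqrt y - 1))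
    + k t * (2 * (d - 1 / 4) * sqrt x / sqrt y - 2 * (d - 1 / 4))
    + be t * (- (d - 1 / 4) * (/ sqrt y - 1)).
Proof using jXi jGa jLa e_xx e_yy e_xy e_x e_y dT1.
  intros Hx Hy; pose proof (sqrt_lt_R0 y Hy).
  rewrite La_from_side, k1_zero by auto.
  rewrite (increment_from_1 (fun s => La 1 s t)
    (fun s => T2 t * s + 2 * be1 t * sqrt s - (d - 1 / 4) * (be t - 2 * k t) / sqrt s)
    (fun s => Lay 1 s t) y Hy).
  - rewrite sqrt_1; field; lra.
  - intros s Hs; apply (jet_y _ _ _ _ _ _ jLa); lra.
  - intros s Hs; pose proof (sqrt_lt_R0 s Hs).
    rewrite Lay_form, k1_zero, sqrt_1 by lra.
    auto_derive; [repeat split; lra | field; lra].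
Qed.

Lemma Laxx_form x y t : 0 < x -> 0 < y ->
  Laxx x y t = - (al1 t + k t * (d - 1 / 4) / sqrt y) / (2 * sqrt x ^ 3).
Proof using jXi jGa jLa e_xx e_yy e_xy e_x e_y dT1.
  intros Hx Hy; pose proof (sqrt_lt_R0 x Hx); pose proof (sqrt_lt_R0 y Hy).
  eapply (is_derive_determined_pos (fun s => Lax s y t)); [exact Hx | | |].
  - intros s Hs; rewrite Lax_form, k1_zero by auto; reflexivity.
  - apply (jet_xx _ _ _ _ _ _ jLa); auto.
  - auto_derive; [repeat split; try lra; apply Rgt_not_eq, Rmult_lt_0_compat; auto | field; lra].
Qed.

Lemma Layy_form x y t : 0 < x -> 0 < y ->
  Layy x y t = - be1 t / (2 * sqrt y ^ 3)
    - 3 * (d - 1 / 4) * (be t - 2 * k t * sqrt x) / (4 * sqrt y ^ 5).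
Proof using jXi jGa jLa e_xx e_yy e_xy e_x e_y dT1.
  intros Hx Hy; pose proof (sqrt_lt_R0 y Hy).
  eapply (is_derive_determined_pos (fun s => Lay x s t)); [exact Hy | | |].
  - intros s Hs; rewrite Lay_form, k1_zero by auto; reflexivity.
  - apply (jet_yy _ _ _ _ _ _ jLa); auto.
  - auto_derive; [repeat split; try lra | field; lra].
    apply Rgt_not_eq; repeat apply Rmult_lt_0_compat; lra.
Qed.

(** As [k1] vanishes identically, [al1] and [be1] are [Xit 1 1] and [Gat 1 1] minus [T2]; these are
    their derivatives. *)
Let al2 t := Xitt 1 1 t - T3 t.
Let be2 t := Gatt 1 1 t - T3 t.

Lemma dal1 t : is_derive al1 t (al2 t).
Proof using dXitt dT2 jXi jGa jLa e_xx e_yy e_xy e_x e_y dT1.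
  apply (is_derive_ext (fun t => Xit 1 1 t - T2 t)).
  - intros s; unfold al1; rewrite k1_zero; cbn; ring.
  - apply (is_derive_minus (fun s => Xit 1 1 s) T2); [apply dXitt; lra | apply dT2].
Qed.

Lemma dbe1 t : is_derive be1 t (be2 t).
Proof using dGatt dT2 jXi jGa jLa e_xx e_yy e_xy e_x e_y dT1.
  apply (is_derive_ext (fun t => Gat 1 1 t - T2 t)).
  - intros s; unfold be1; rewrite k1_zero; cbn; ring.
  - apply (is_derive_minus (fun s => Gat 1 1 s) T2); [apply dGatt; lra | apply dT2].
Qed.

Lemma Lat_form x y t : 0 < x -> 0 < y ->
  Lat x y t = Lat 1 1 t + T3 t * (x + y - 2) + al2 t * (2 * (sqrt x - 1))
    + be2 t * (2 * (sqrt y - 1)) + be1 t * (- (d - 1 / 4) * (/ sqrt y - 1)).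
Proof using dXitt dGatt dT2 jXi jGa jLa e_xx e_yy e_xy e_x e_y dT1.
  intros Hx Hy.
  (* The term with factor [k1 t = 0] is put back, so that the sum matches [La_form] summand by
     summand. *)
  rewrite <- (Rplus_0_r (_ + be2 t * _)).
  rewrite <- (Rmult_0_l (2 * (d - 1 / 4) * sqrt x / sqrt y - 2 * (d - 1 / 4))).
  rewrite <- (k1_zero t).
  eapply (is_derive_determined (fun s => La x y s)).
  - intros s; apply La_form; auto.
  - apply (jet_t _ _ _ _ _ _ jLa); auto.
  - repeat apply is_derive_Rplus; [apply (jet_t _ _ _ _ _ _ jLa); lra | | | | |];
      apply is_derive_Rmult_const; [apply dT2 | apply dal1 | apply dbe1 | apply dk | apply dbe].
Qed.

(** [e_1], the coefficient of [u], written in sqrt x and sqrt y. In d Lay + y Layy / 2 the terms in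
    [be] and [k] acquire d / 2 - 3 / 8, the source of the second factor d - 3/4; the [k] terms of
    Lax / 4 and x Laxx / 2 cancel. *)
Lemma determining_constant x y t : 0 < x -> 0 < y ->
  (d - 1 / 4) * (d - 3 / 4) / 2 * be t / sqrt y ^ 3
  - (d - 1 / 4) * (d - 3 / 4) * k t * sqrt x / sqrt y ^ 3
  + T3 t * (sqrt x ^ 2 + sqrt y ^ 2) + 2 * al2 t * sqrt x + 2 * be2 t * sqrt y
  + (T2 t * (1 / 4 + d) + Lat 1 1 t - 2 * T3 t - 2 * al2 t - 2 * be2 t
     + (d - 1 / 4) * be1 t) = 0.
Proof using dXitt dGatt dT2 jXi jGa jLa e_xx e_yy e_xy e_x e_y dT1 e_1.
  intros Hx Hy; rewrite <- (e_1 x y t Hx Hy).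
  rewrite Lax_form, Lay_form, Laxx_form, Layy_form, (Lat_form x y), k1_zero by auto.
  destruct (sqrt_pos_square x Hx) as [Hr Hxx], (sqrt_pos_square y Hy) as [Hs Hyy].
  set (r := sqrt x) in *; set (s := sqrt y) in *; rewrite Hxx, Hyy; field; lra.
Qed.

Hypotheses (hd : d <> 1 / 4) (hd' : d <> 3 / 4).

Lemma determining_zero t :
  be t = 0 /\ k t = 0 /\ T3 t = 0 /\ al2 t = 0 /\
  T2 t * (1 / 4 + d) + Lat 1 1 t + (d - 1 / 4) * be1 t = 0.
Proof using All.
  assert (H : forall r s, 0 < r -> 0 < s ->
    (d - 1 / 4) * (d - 3 / 4) / 2 * be t / s ^ 3
    - (d - 1 / 4) * (d - 3 / 4) * k t * r / s ^ 3
    + T3 t * (r ^ 2 + s ^ 2) + 2 * al2 t * r + 2 * be2 t * s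
    + (T2 t * (1 / 4 + d) + Lat 1 1 t - 2 * T3 t - 2 * al2 t - 2 * be2 t
       + (d - 1 / 4) * be1 t) = 0).
  { intros r s Hr Hs.
    pose proof (determining_constant (r * r) (s * s) t) as H.
    rewrite !sqrt_square in H by lra; apply H; apply Rmult_lt_0_compat; assumption. }
  assert (Hd : (d - 1 / 4) * (d - 3 / 4) <> 0)
    by (apply Rmult_integral_contrapositive_currified; lra).
  (* The functions 1/s^3, r/s^3, r^2 + s^2, r, s and 1 are linearly independent on these six points
     (r, s), so all six coefficients vanish. *)
  assert (H11 := H 1 1 ltac:(lra) ltac:(lra)); assert (H21 := H 2 1 ltac:(lra) ltac:(lra)).
  assert (H31 := H 3 1 ltac:(lra) ltac:(lra)); assert (H12 := H 1 2 ltac:(lra) ltac:(lra)).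
  assert (H22 := H 2 2 ltac:(lra) ltac:(lra)); assert (H13 := H 1 3 ltac:(lra) ltac:(lra)).
  clear H; revert Hd H11 H21 H31 H12 H22 H13.
  set (D := (d - 1 / 4) * (d - 3 / 4)); set (C := (d - 1 / 4) * be1 t).
  intros Hd H11 H21 H31 H12 H22 H13.
  assert (Hbe : D * be t = 0) by lra.
  assert (Hk : D * k t = 0) by lra.
  apply Rmult_integral in Hbe, Hk.
  destruct Hbe as [|Hbe]; [contradiction|]; destruct Hk as [|Hk]; [contradiction|].
  rewrite Hbe, Hk in *.
  repeat split; lra.
Qed.

(** [be] vanishes at every time, hence so does its derivative. *)
Lemma be1_zero t : be1 t = 0.
Proof using All.
  apply (is_derive_determined be (fun _ => 0) t);
    [intros s; apply determining_zero | apply dbe | apply (is_derive_const 0)].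
Qed.

Lemma quadrant_solutions :
  exists mE mF mH mX mY mZ : R, forall x y t, 0 < x -> 0 < y ->
    T t = mE * t ^ 2 + 2 * mH * t - mF /\
    Xi x y t = 2 * mE * t * x + 2 * mH * x - mX * t * sqrt x + mY * sqrt x /\
    Ga x y t = 2 * mE * t * y + 2 * mH * y /\
    La x y t = mE * (2 * (x + y) - 2 * (1 / 4 + d) * t) - (2 * d + 1 / 2) * mH
      - 2 * mX * sqrt x + mZ.
Proof using All.
  assert (dT2' : forall t, is_derive T2 t 0).
  { intros t; pose proof (dT2 t) as H; destruct (determining_zero t) as [_ [_ [E _]]].
    rewrite E in H; exact H. }
  pose proof (quadratic_of_third_derivative_zero T T1 T2 dT dT1 dT2') as ET.
  assert (Eal1 : forall t, al1 t = al1 0).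
  { intros t; rewrite (affine_of_constant_derivative al1 0 t); [ring|].
    intros s; pose proof (dal1 s) as H; destruct (determining_zero s) as [_ [_ [_ [E _]]]].
    rewrite E in H; exact H. }
  assert (Eal : forall t, al t = al 0 + al1 0 * t).
  { intros t; apply affine_of_constant_derivative; intros s; rewrite <- (Eal1 s); apply dal. }
  assert (ELa : forall t, La 1 1 t = La 1 1 0 + - (T2 0 * (1 / 4 + d)) * t).
  { intros t; apply (affine_of_constant_derivative (fun s => La 1 1 s)); intros s.
    replace (- (T2 0 * (1 / 4 + d))) with (Lat 1 1 s); [apply (jet_t _ _ _ _ _ _ jLa); lra|].
    destruct (determining_zero s) as [_ [_ [_ [_ E]]]].
    rewrite be1_zero, (proj1 (ET s)) in E; lra. }
  (* Constants of integration in the normalization of [quadrant_field]. The last one solves the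
     formula for [La] at x = y = 1, t = 0 for mZ, where x + y and sqrt x contribute the terms in
     [T2 0] and [al1 0]. *)
  exists (T2 0 / 2), (- T 0), (T1 0 / 2), (- al1 0), (al 0),
    (La 1 1 0 - 2 * T2 0 - 2 * al1 0 + (2 * d + 1 / 2) * (T1 0 / 2)).
  intros x y t Hx Hy; destruct (ET t) as [E2 [E1 E0]].
  destruct (determining_zero t) as [Hbe [Hk _]].
  repeat split.
  - rewrite E0; field.
  - rewrite Xi_form, Hk, Eal, E1 by auto; field.
  - rewrite Ga_form, Hk, Hbe, E1 by auto; field.
  - rewrite La_form, ELa, Hbe, Hk, be1_zero, Eal1, E2 by auto; field.
    apply Rgt_not_eq, sqrt_lt_R0, Hy.
Qed.
End QuadrantSolutions.

(** * Symmetries of the two-dimensional equation *)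

Definition xytu (x y t u : R) : point (withU xyt_index) := fun k =>
  match k with Some cx => x | Some cy => y | Some ct => t | None => u end.

Lemma xytu_eta (z : point (withU xyt_index)) :
  z = xytu (z (Some cx)) (z (Some cy)) (z (Some ct)) (z None).
Proof. extensionality k; destruct k as [[]|]; reflexivity. Qed.

Lemma xytu_upd_x x y t u s : upd (xytu x y t u) (Some cx) s = xytu s y t u.
Proof. extensionality k; destruct k as [[]|]; reflexivity. Qed.

Lemma xytu_upd_y x y t u s : upd (xytu x y t u) (Some cy) s = xytu x s t u.
Proof. extensionality k; destruct k as [[]|]; reflexivity. Qed.

Lemma xytu_upd_t x y t u s : upd (xytu x y t u) (Some ct) s = xytu x y s u.
Proof. extensionality k; destruct k as [[]|]; reflexivity. Qed.

Lemma xytu_upd_u x y t u s : upd (xytu x y t u) None s = xytu x y t s.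
Proof. extensionality k; destruct k as [[]|]; reflexivity. Qed.

Lemma open_quadrant : open quadrant.
Proof.
  intros z [Hx Hy].
  exists (mkposreal _ (Rmin_pos _ _ Hx Hy)); intros w Hw.
  pose proof (Hw (Some cx)) as Wx; pose proof (Hw (Some cy)) as Wy.
  apply Rabs_def2 in Wx, Wy; unfold minus, plus, opp in Wx, Wy; cbn in Wx, Wy.
  pose proof (Rmin_l (z (Some cx)) (z (Some cy))) as Ml.
  pose proof (Rmin_r (z (Some cx)) (z (Some cy))) as Mr.
  split; cbn in *; lra.
Qed.

Definition quadrant_pt x y t u (Hx : 0 < x) (Hy : 0 < y) : pt quadrant :=
  exist quadrant (xytu x y t u) (conj Hx Hy).

Lemma quadrant_pos (z : pt quadrant) : 0 < pt_val z (Some cx) /\ 0 < pt_val z (Some cy).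
Proof. exact (proj2_sig z). Qed.

Section QuadrantPartials.
Variables (f : pt quadrant -> R) (F : R -> R -> R -> R -> R).
Hypothesis fF : forall z : pt quadrant,
  f z = F (pt_val z (Some cx)) (pt_val z (Some cy)) (pt_val z (Some ct)) (pt_val z None).

Let F' (w : point (withU xyt_index)) := F (w (Some cx)) (w (Some cy)) (w (Some ct)) (w None).

Lemma quadrant_partial_x (z : pt quadrant) l :
  is_derive (fun s => F s (pt_val z (Some cy)) (pt_val z (Some ct)) (pt_val z None))
    (pt_val z (Some cx)) l ->
  partial (Some cx) f z = l.
Proof using fF.
  apply (partial_represented open_quadrant f F' fF (Some cx : withU xyt_index)).
Qed.

Lemma quadrant_partial_y (z : pt quadrant) l :
  is_derive (fun s => F (pt_val z (Some cx)) s (pt_val z (Some ct)) (pt_val z None))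
    (pt_val z (Some cy)) l ->
  partial (Some cy) f z = l.
Proof using fF.
  apply (partial_represented open_quadrant f F' fF (Some cy : withU xyt_index)).
Qed.

Lemma quadrant_partial_t (z : pt quadrant) l :
  is_derive (fun s => F (pt_val z (Some cx)) (pt_val z (Some cy)) s (pt_val z None))
    (pt_val z (Some ct)) l ->
  partial (Some ct) f z = l.
Proof using fF.
  apply (partial_represented open_quadrant f F' fF (Some ct : withU xyt_index)).
Qed.

Lemma quadrant_partial_u (z : pt quadrant) l :
  is_derive (fun s => F (pt_val z (Some cx)) (pt_val z (Some cy)) (pt_val z (Some ct)) s)
    (pt_val z None) l ->
  partial None f z = l.
Proof using fF.
  apply (partial_represented open_quadrant f F' fF (None : withU xyt_index)).
Qed.
End QuadrantPartials.

Section QuadrantSmooth.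
Variables (f : pt quadrant -> R) (x y t u : R).
Hypotheses (f_smooth : smooth f) (Hx : 0 < x) (Hy : 0 < y).

Lemma smooth_derive_x :
  is_derive (fun s => ext f (xytu s y t u)) x (ext (partial (Some cx) f) (xytu x y t u)).
Proof using f_smooth Hx Hy.
  pose proof (is_derive_partial (Some cx) f (quadrant_pt x y t u Hx Hy)
    (smooth_ex_partial _ _ _ f_smooth)) as H.
  rewrite <- ext_pt in H; revert H; apply is_derive_ext.
  intros s; cbn; rewrite xytu_upd_x; reflexivity.
Qed.

Lemma smooth_derive_y :
  is_derive (fun s => ext f (xytu x s t u)) y (ext (partial (Some cy) f) (xytu x y t u)).
Proof using f_smooth Hx Hy.
  pose proof (is_derive_partial (Some cy) f (quadrant_pt x y t u Hx Hy)
    (smooth_ex_partial _ _ _ f_smooth)) as H.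
  rewrite <- ext_pt in H; revert H; apply is_derive_ext.
  intros s; cbn; rewrite xytu_upd_y; reflexivity.
Qed.

Lemma smooth_derive_time :
  is_derive (fun s => ext f (xytu x y s u)) t (ext (partial (Some ct) f) (xytu x y t u)).
Proof using f_smooth Hx Hy.
  pose proof (is_derive_partial (Some ct) f (quadrant_pt x y t u Hx Hy)
    (smooth_ex_partial _ _ _ f_smooth)) as H.
  rewrite <- ext_pt in H; revert H; apply is_derive_ext.
  intros s; cbn; rewrite xytu_upd_t; reflexivity.
Qed.
End QuadrantSmooth.

(** * Prolongation on the quadrant and the coefficients of the mixed second derivatives *)

Section QuadrantProlongation.
Variable d : R.
Let Delta := Delta2 (1 / 4) 0 d 0.

Lemma quadrant_pr2_apply (v : vfield quadrant) z p q :
  pr2_apply v Delta z p q =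
    pr1 v cx z p / 4 + d * pr1 v cy z p + pr1 v ct z p
    + v (Some cx) z / 2 * q cx cx + v (Some cy) z / 2 * q cy cy
    + pt_val z (Some cx) / 2 * pr2 v cx cx z p q
    + pt_val z (Some cy) / 2 * pr2 v cy cy z p q.
Proof.
  apply is_derive_unique; unfold Delta, Delta2.
  auto_derive; [trivial | field].
Qed.

Lemma quadrant_pr2_affine (v : vfield quadrant) i z p q :
  pr2 v i i z p q =
    partial (Some i) (fun y => pr1 v i y p) z
    + p i * partial None (fun y => pr1 v i y p) z
    + q i i * (partial None (v None) z - p cx * partial None (v (Some cx)) z
        - p cy * partial None (v (Some cy)) z - p ct * partial None (v (Some ct)) z)
    - 2 * (q i cx * total0 i (v (Some cx)) z p + q i cy * total0 i (v (Some cy)) z p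
        + q i ct * total0 i (v (Some ct)) z p).
Proof.
  unfold pr2, total1, isum; cbn.
  assert (H : forall k, Derive (fun s => pr1 v i z (upd p k s)) (p k)
    = (if idx_dec xyt_index k i
       then partial None (v None) z - p cx * partial None (v (Some cx)) z
        - p cy * partial None (v (Some cy)) z - p ct * partial None (v (Some ct)) z else 0)
      - total0 i (v (Some k)) z p).
  { intros k; apply Derive_eq; unfold pr1, total0, isum, upd.
    destruct i, k; cbn; auto_derive; trivial; coord_ring. }
  rewrite !H; destruct i; cbn; coord_ring.
Qed.

Definition quadrant_p (px py pt : R) : xyt_index -> R :=
  fun i => match i with cx => px | cy => py | ct => pt end.
Definition quadrant_q (qxx qxy qyy qxt qyt : R) : xyt_index -> xyt_index -> R :=
  fun i j => match i, j with
    | cx, cx => qxx | cy, cy => qyy | ct, ct => 0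
    | cx, cy | cy, cx => qxy | cx, ct | ct, cx => qxt | cy, ct | ct, cy => qyt
    end.

Section QuadrantSymmetry.
Variable v : vfield quadrant.
Hypothesis v_sym : is_symmetry Delta v.

(** The equation is solved for [u_t], so the remaining jet coordinates can be chosen freely. *)
Lemma quadrant_symmetry_eq z px py qxx qxy qyy qxt qyt :
  let x := pt_val z (Some cx) in
  let y := pt_val z (Some cy) in
  pr2_apply v Delta z
    (quadrant_p px py (- (px / 4 + d * py + x / 2 * qxx + y / 2 * qyy)))
    (quadrant_q qxx qxy qyy qxt qyt) = 0.
Proof using v_sym.
  apply v_sym; [intros [] []; reflexivity | unfold Delta, Delta2; cbn; field].
Qed.

(** The coefficients of [u_xt] and [u_yt] in the symmetry condition are - x D_x tau and - y D_y tau,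
    and x, y > 0. *)
Lemma quadrant_tau_total z px py pt :
  total0 cx (v (Some ct)) z (quadrant_p px py pt) = 0 /\
  total0 cy (v (Some ct)) z (quadrant_p px py pt) = 0.
Proof using v_sym.
  pose proof (quadrant_symmetry_eq z px py 0 0 0 0 0) as H0.
  pose proof (quadrant_symmetry_eq z px py 0 0 0 1 0) as Hx.
  pose proof (quadrant_symmetry_eq z px py 0 0 0 0 1) as Hy.
  cbv zeta in *; rewrite quadrant_pr2_apply, !quadrant_pr2_affine in H0, Hx, Hy.
  destruct (quadrant_pos z) as [Zx Zy]; unfold total0 in *; cbn in *.
  split; [ apply (Rmult_eq_reg_l (pt_val z (Some cx)))
         | apply (Rmult_eq_reg_l (pt_val z (Some cy)))];
    cbn; coord_lra.
Qed.

Lemma quadrant_tau_derivatives z :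
  partial (Some cx) (v (Some ct)) z = 0 /\ partial (Some cy) (v (Some ct)) z = 0 /\
  partial None (v (Some ct)) z = 0.
Proof using v_sym.
  pose proof (quadrant_tau_total z 0 0 0) as [H1 H2].
  pose proof (quadrant_tau_total z 1 0 0) as [H3 _].
  unfold total0 in *; cbn in *; repeat split; coord_lra.
Qed.

(* The coefficient of [u_xy]. *)
Lemma quadrant_mixed z px py pt :
  pt_val z (Some cx) * total0 cx (v (Some cy)) z (quadrant_p px py pt)
  + pt_val z (Some cy) * total0 cy (v (Some cx)) z (quadrant_p px py pt) = 0.
Proof using v_sym.
  pose proof (quadrant_symmetry_eq z px py 0 0 0 0 0) as H0.
  pose proof (quadrant_symmetry_eq z px py 0 1 0 0 0) as H1.
  cbv zeta in *; rewrite quadrant_pr2_apply, !quadrant_pr2_affine in H0, H1.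
  unfold total0 in *; cbn in *; coord_lra.
Qed.

(** y xi_u is the coefficient of [u_y] in [quadrant_mixed]. The second space variable thus settles
    what for the heat equation had to be taken from the coefficient of [u_qq]. *)
Lemma quadrant_xi_u z : partial None (v (Some cx)) z = 0.
Proof using v_sym.
  pose proof (quadrant_mixed z 0 0 0) as H0; pose proof (quadrant_mixed z 0 1 0) as H1.
  destruct (quadrant_pos z) as [Zx Zy]; unfold total0 in *; cbn in *.
  apply (Rmult_eq_reg_l (pt_val z (Some cy))); cbn; coord_lra.
Qed.

Lemma quadrant_gamma_u z : partial None (v (Some cy)) z = 0.
Proof using v_sym.
  pose proof (quadrant_mixed z 0 0 0) as H0; pose proof (quadrant_mixed z 1 0 0) as H1.
  destruct (quadrant_pos z) as [Zx Zy]; unfold total0 in *; cbn in *.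
  apply (Rmult_eq_reg_l (pt_val z (Some cx))); cbn; coord_lra.
Qed.
End QuadrantSymmetry.

End QuadrantProlongation.

(** * The symmetry condition for fields of reduced form *)

Section QuadrantReduced.
Variables (v : vfield quadrant) (T T1 : R -> R)
  (Xi Xix Xixx Xiy Xiyy Xit Ga Gax Gaxx Gay Gayy Gat
   La Lax Laxx Lay Layy Lat : R -> R -> R -> R).
Hypotheses
  (v_t : forall z, v (Some ct) z = T (pt_val z (Some ct)))
  (v_x : forall z, v (Some cx) z
    = Xi (pt_val z (Some cx)) (pt_val z (Some cy)) (pt_val z (Some ct)))
  (v_y : forall z, v (Some cy) z
    = Ga (pt_val z (Some cx)) (pt_val z (Some cy)) (pt_val z (Some ct)))
  (v_u : forall z, v None z
    = La (pt_val z (Some cx)) (pt_val z (Some cy)) (pt_val z (Some ct)) * pt_val z None)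
  (dT : forall t, is_derive T t (T1 t))
  (jXi : jet Xi Xix Xixx Xiy Xiyy Xit)
  (jGa : jet Ga Gax Gaxx Gay Gayy Gat)
  (jLa : jet La Lax Laxx Lay Layy Lat).

Lemma quadrant_partials_tau z :
  partial (Some cx) (v (Some ct)) z = 0 /\ partial (Some cy) (v (Some ct)) z = 0 /\
  partial (Some ct) (v (Some ct)) z = T1 (pt_val z (Some ct)) /\
  partial None (v (Some ct)) z = 0.
Proof using v_t dT.
  pose (F := fun x y t u : R => T t); repeat split.
  - apply (quadrant_partial_x _ F v_t), (is_derive_const (T _)).
  - apply (quadrant_partial_y _ F v_t), (is_derive_const (T _)).
  - apply (quadrant_partial_t _ F v_t), dT.
  - apply (quadrant_partial_u _ F v_t), (is_derive_const (T _)).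
Qed.

Lemma quadrant_partials_base w G Gx Gxx Gy Gyy Gt z :
  (forall z : pt quadrant,
    w z = G (pt_val z (Some cx)) (pt_val z (Some cy)) (pt_val z (Some ct))) ->
  jet G Gx Gxx Gy Gyy Gt ->
  let x := pt_val z (Some cx) in
  let y := pt_val z (Some cy) in
  let t := pt_val z (Some ct) in
  partial (Some cx) w z = Gx x y t /\ partial (Some cy) w z = Gy x y t /\
  partial (Some ct) w z = Gt x y t /\ partial None w z = 0.
Proof.
  intros wG j; cbv zeta; destruct (quadrant_pos z) as [Zx Zy].
  pose (F := fun x y t u : R => G x y t); repeat split.
  - apply (quadrant_partial_x _ F wG), (jet_x _ _ _ _ _ _ j); assumption.
  - apply (quadrant_partial_y _ F wG), (jet_y _ _ _ _ _ _ j); assumption.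
  - apply (quadrant_partial_t _ F wG), (jet_t _ _ _ _ _ _ j); assumption.
  - apply (quadrant_partial_u _ F wG), (is_derive_const (G _ _ _)).
Qed.

Lemma quadrant_partials_phi z :
  let x := pt_val z (Some cx) in
  let y := pt_val z (Some cy) in
  let t := pt_val z (Some ct) in
  let u := pt_val z None in
  partial (Some cx) (v None) z = Lax x y t * u /\ partial (Some cy) (v None) z = Lay x y t * u /\
  partial (Some ct) (v None) z = Lat x y t * u /\ partial None (v None) z = La x y t.
Proof using v_u jLa.
  cbv zeta; destruct (quadrant_pos z) as [Zx Zy].
  pose (F := fun x y t u : R => La x y t * u); repeat split.
  - apply (quadrant_partial_x _ F v_u), is_derive_Rmult_const, (jet_x _ _ _ _ _ _ jLa); assumption.
  - apply (quadrant_partial_y _ F v_u), is_derive_Rmult_const, (jet_y _ _ _ _ _ _ jLa); assumption.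
  - apply (quadrant_partial_t _ F v_u), is_derive_Rmult_const, (jet_t _ _ _ _ _ _ jLa); assumption.
  - apply (quadrant_partial_u _ F v_u); unfold F; auto_derive; [trivial | coord_ring].
Qed.

Lemma quadrant_pr1_x z p :
  let x := pt_val z (Some cx) in
  let y := pt_val z (Some cy) in
  let t := pt_val z (Some ct) in
  pr1 v cx z p = Lax x y t * pt_val z None + La x y t * p cx - Xix x y t * p cx
    - Gax x y t * p cy.
Proof using All.
  unfold pr1, total0, isum; cbn.
  destruct (quadrant_partials_tau z) as [Tx [_ [_ Tu]]].
  destruct (quadrant_partials_base _ _ _ _ _ _ _ z v_x jXi) as [Xx [_ [_ Xu]]].
  destruct (quadrant_partials_base _ _ _ _ _ _ _ z v_y jGa) as [Yx [_ [_ Yu]]].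
  destruct (quadrant_partials_phi z) as [Ux [_ [_ Uu]]].
  coord_norm; rewrite Tx, Tu, Xx, Xu, Yx, Yu, Ux, Uu; coord_ring.
Qed.

Lemma quadrant_pr1_y z p :
  let x := pt_val z (Some cx) in
  let y := pt_val z (Some cy) in
  let t := pt_val z (Some ct) in
  pr1 v cy z p = Lay x y t * pt_val z None + La x y t * p cy - Xiy x y t * p cx
    - Gay x y t * p cy.
Proof using All.
  unfold pr1, total0, isum; cbn.
  destruct (quadrant_partials_tau z) as [_ [Ty [_ Tu]]].
  destruct (quadrant_partials_base _ _ _ _ _ _ _ z v_x jXi) as [_ [Xy [_ Xu]]].
  destruct (quadrant_partials_base _ _ _ _ _ _ _ z v_y jGa) as [_ [Yy [_ Yu]]].
  destruct (quadrant_partials_phi z) as [_ [Uy [_ Uu]]].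
  coord_norm; rewrite Ty, Tu, Xy, Xu, Yy, Yu, Uy, Uu; coord_ring.
Qed.

Lemma quadrant_pr1_t z p :
  let x := pt_val z (Some cx) in
  let y := pt_val z (Some cy) in
  let t := pt_val z (Some ct) in
  pr1 v ct z p = Lat x y t * pt_val z None + La x y t * p ct - Xit x y t * p cx
    - Gat x y t * p cy - T1 t * p ct.
Proof using All.
  unfold pr1, total0, isum; cbn.
  destruct (quadrant_partials_tau z) as [_ [_ [Tt Tu]]].
  destruct (quadrant_partials_base _ _ _ _ _ _ _ z v_x jXi) as [_ [_ [Xt Xu]]].
  destruct (quadrant_partials_base _ _ _ _ _ _ _ z v_y jGa) as [_ [_ [Yt Yu]]].
  destruct (quadrant_partials_phi z) as [_ [_ [Ut Uu]]].
  coord_norm; rewrite Tt, Tu, Xt, Xu, Yt, Yu, Ut, Uu; coord_ring.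
Qed.

Lemma quadrant_pr2_x z p q :
  let x := pt_val z (Some cx) in
  let y := pt_val z (Some cy) in
  let t := pt_val z (Some ct) in
  pr2 v cx cx z p q = Laxx x y t * pt_val z None + 2 * p cx * Lax x y t + q cx cx * La x y t
    - 2 * q cx cx * Xix x y t - 2 * q cx cy * Gax x y t - p cx * Xixx x y t - p cy * Gaxx x y t.
Proof using All.
  cbv zeta; rewrite quadrant_pr2_affine; unfold total0.
  destruct (quadrant_partials_tau z) as [Tx [_ [_ Tu]]].
  destruct (quadrant_partials_base _ _ _ _ _ _ _ z v_x jXi) as [Xx [_ [_ Xu]]].
  destruct (quadrant_partials_base _ _ _ _ _ _ _ z v_y jGa) as [Yx [_ [_ Yu]]].
  destruct (quadrant_partials_phi z) as [_ [_ [_ Uu]]].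
  coord_norm; rewrite Tx, Tu, Xx, Xu, Yx, Yu, Uu.
  pose (F := fun x y t u : R => Lax x y t * u + La x y t * p cx - Xix x y t * p cx
    - Gax x y t * p cy).
  (* The type ascription presents [pr1] as a formula in the four coordinates, as the lemmas on
     partial derivatives expect. *)
  pose proof (fun z => quadrant_pr1_x z p : _ = F _ _ _ _) as P1.
  destruct (quadrant_pos z) as [Zx Zy].
  erewrite (quadrant_partial_x _ F P1), (quadrant_partial_u _ F P1); unfold F.
  2: auto_derive; [trivial | reflexivity].
  2:{ apply (is_derive_minus (V := R_NormedModule));
        [apply (is_derive_minus (V := R_NormedModule))|];
      [apply is_derive_Rplus| |]; apply is_derive_Rmult_const.
      - apply (jet_xx _ _ _ _ _ _ jLa); assumption.
      - apply (jet_x _ _ _ _ _ _ jLa); assumption.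
      - apply (jet_xx _ _ _ _ _ _ jXi); assumption.
      - apply (jet_xx _ _ _ _ _ _ jGa); assumption. }
  unfold minus, plus, opp; cbn; coord_ring.
Qed.

Lemma quadrant_pr2_y z p q :
  let x := pt_val z (Some cx) in
  let y := pt_val z (Some cy) in
  let t := pt_val z (Some ct) in
  pr2 v cy cy z p q = Layy x y t * pt_val z None + 2 * p cy * Lay x y t + q cy cy * La x y t
    - 2 * q cy cx * Xiy x y t - 2 * q cy cy * Gay x y t - p cx * Xiyy x y t - p cy * Gayy x y t.
Proof using All.
  cbv zeta; rewrite quadrant_pr2_affine; unfold total0.
  destruct (quadrant_partials_tau z) as [_ [Ty [_ Tu]]].
  destruct (quadrant_partials_base _ _ _ _ _ _ _ z v_x jXi) as [_ [Xy [_ Xu]]].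
  destruct (quadrant_partials_base _ _ _ _ _ _ _ z v_y jGa) as [_ [Yy [_ Yu]]].
  destruct (quadrant_partials_phi z) as [_ [_ [_ Uu]]].
  coord_norm; rewrite Ty, Tu, Xy, Xu, Yy, Yu, Uu.
  pose (F := fun x y t u : R => Lay x y t * u + La x y t * p cy - Xiy x y t * p cx
    - Gay x y t * p cy).
  pose proof (fun z => quadrant_pr1_y z p : _ = F _ _ _ _) as P1.
  destruct (quadrant_pos z) as [Zx Zy].
  erewrite (quadrant_partial_y _ F P1), (quadrant_partial_u _ F P1); unfold F.
  2: auto_derive; [trivial | reflexivity].
  2:{ apply (is_derive_minus (V := R_NormedModule));
        [apply (is_derive_minus (V := R_NormedModule))|];
      [apply is_derive_Rplus| |]; apply is_derive_Rmult_const.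
      - apply (jet_yy _ _ _ _ _ _ jLa); assumption.
      - apply (jet_y _ _ _ _ _ _ jLa); assumption.
      - apply (jet_yy _ _ _ _ _ _ jXi); assumption.
      - apply (jet_yy _ _ _ _ _ _ jGa); assumption. }
  unfold minus, plus, opp; cbn; coord_ring.
Qed.

Lemma quadrant_pr2_reduced d z p q :
  let x := pt_val z (Some cx) in
  let y := pt_val z (Some cy) in
  let t := pt_val z (Some ct) in
  let u := pt_val z None in
  pr2_apply v (Delta2 (1 / 4) 0 d 0) z p q =
    (Lax x y t * u + La x y t * p cx - Xix x y t * p cx - Gax x y t * p cy) / 4
    + d * (Lay x y t * u + La x y t * p cy - Xiy x y t * p cx - Gay x y t * p cy)
    + (Lat x y t * u + La x y t * p ct - Xit x y t * p cx - Gat x y t * p cy - T1 t * p ct)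
    + Xi x y t / 2 * q cx cx + Ga x y t / 2 * q cy cy
    + x / 2 * (Laxx x y t * u + 2 * p cx * Lax x y t + q cx cx * La x y t
        - 2 * q cx cx * Xix x y t - 2 * q cx cy * Gax x y t
        - p cx * Xixx x y t - p cy * Gaxx x y t)
    + y / 2 * (Layy x y t * u + 2 * p cy * Lay x y t + q cy cy * La x y t
        - 2 * q cy cx * Xiy x y t - 2 * q cy cy * Gay x y t
        - p cx * Xiyy x y t - p cy * Gayy x y t).
Proof using All.
  cbv zeta; rewrite quadrant_pr2_apply, quadrant_pr1_x, quadrant_pr1_y, quadrant_pr1_t,
    quadrant_pr2_x, quadrant_pr2_y, v_x, v_y; reflexivity.
Qed.
End QuadrantReduced.

(** * The general symmetry on the quadrant and its parametrization by M *)

Section QuadrantExtraction.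
Variables (d : R) (v : vfield quadrant).
Hypotheses (hd : d <> 1 / 4) (hd' : d <> 3 / 4) (v_sym : calL (1 / 4) 0 d 0 v).

Lemma quadrant_form :
  exists mE mF mH mX mY mZ : R, forall z : pt quadrant,
    let x := pt_val z (Some cx) in
    let y := pt_val z (Some cy) in
    let t := pt_val z (Some ct) in
    v (Some ct) z = mE * t ^ 2 + 2 * mH * t - mF /\
    v (Some cx) z = 2 * mE * t * x + 2 * mH * x - mX * t * sqrt x + mY * sqrt x /\
    v (Some cy) z = 2 * mE * t * y + 2 * mH * y /\
    v None z = (mE * (2 * (x + y) - 2 * (1 / 4 + d) * t) - (2 * d + 1 / 2) * mH
      - 2 * mX * sqrt x + mZ) * pt_val z None.
Proof using All.
  destruct v_sym as [sym [lambda v_lambda]].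
  pose proof (proj1 sym) as sm.
  pose (T := fun (f : pt quadrant -> R) t => ext f (xytu 1 1 t 0)).
  pose (F := fun (c : R) (f : pt quadrant -> R) x y t => ext f (xytu x y t c)).
  pose (tau := v (Some ct)); pose (xi := v (Some cx)); pose (ga := v (Some cy)).
  pose (phi := v None).
  pose (dx := partial (D := quadrant) (Some cx)); pose (dy := partial (D := quadrant) (Some cy)).
  pose (dt := partial (D := quadrant) (Some ct)).
  assert (sm_tau : smooth tau) by apply sm.
  assert (sm_xi : smooth xi) by apply sm.
  assert (sm_ga : smooth ga) by apply sm.
  assert (sm_phi : smooth phi) by apply sm.
  assert (sm_x : forall f, smooth f -> smooth (dx f)) by (intros; apply smooth_partial; auto).
  assert (sm_y : forall f, smooth f -> smooth (dy f)) by (intros; apply smooth_partial; auto).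
  assert (sm_t : forall f, smooth f -> smooth (dt f)) by (intros; apply smooth_partial; auto).
  assert (dF_t : forall c f, smooth f -> forall x y t, 0 < x -> 0 < y ->
      is_derive (fun s => F c f x y s) t (F c (dt f) x y t))
    by (intros; apply smooth_derive_time; assumption).
  assert (jF : forall c f, smooth f ->
    jet (F c f) (F c (dx f)) (F c (dx (dx f))) (F c (dy f)) (F c (dy (dy f))) (F c (dt f))).
  { intros c f Hf; constructor; intros;
      [ apply smooth_derive_x | apply (smooth_derive_x (dx f))
      | apply smooth_derive_y | apply (smooth_derive_y (dy f)) | apply smooth_derive_time ]; auto. }
  assert (dT : forall f, smooth f -> forall t, is_derive (T f) t (T (dt f) t))
    by (intros; apply smooth_derive_time; auto using Rlt_0_1).
  assert (indep_u : forall (f : pt quadrant -> R) (z : pt quadrant) s,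
    smooth f -> (forall y, partial None f y = 0) ->
    f z = ext f (xytu (pt_val z (Some cx)) (pt_val z (Some cy)) (pt_val z (Some ct)) s)).
  { intros f z s Hf H0; rewrite <- ext_pt, <- (xytu_upd_u _ _ _ (pt_val z None)), <- xytu_eta.
    symmetry; apply constant_of_partial_zero; auto; intros; exact (quadrant_pos z). }
  pose proof (quadrant_tau_derivatives d v sym) as tau_const.
  assert (v_t : forall z : pt quadrant, tau z = T tau (pt_val z (Some ct))).
  { intros z; destruct (quadrant_pos z) as [Zx Zy].
    (* tau is transported to x = y = 1 along coordinate lines; the segment from a positive
       coordinate to 1 stays inside the quadrant. *)
    assert (pos : forall a s, 0 < a -> Rmin a 1 <= s -> 0 < s)
      by (intros a s Ha; apply Rlt_le_trans, Rmin_glb_lt; lra).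
    rewrite (indep_u tau z 0 sm_tau) by apply tau_const; unfold T.
    rewrite <- (xytu_upd_x (pt_val z (Some cx)) 1 (pt_val z (Some ct)) 0 1).
    rewrite <- (xytu_upd_y (pt_val z (Some cx)) (pt_val z (Some cy)) (pt_val z (Some ct)) 0 1).
    symmetry; rewrite constant_of_partial_zero; [rewrite constant_of_partial_zero| | |];
      try assumption; try apply tau_const; try reflexivity.
    - intros r [Hr _]; split; [exact Zx | apply (pos (pt_val z (Some cy))); assumption].
    - intros r [Hr _]; split; [apply (pos (pt_val z (Some cx))); assumption | exact Rlt_0_1]. }
  assert (v_x : forall z : pt quadrant,
      xi z = F 0 xi (pt_val z (Some cx)) (pt_val z (Some cy)) (pt_val z (Some ct)))
    by (intros z; apply indep_u; [assumption | apply (quadrant_xi_u d v sym)]).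
  assert (v_y : forall z : pt quadrant,
      ga z = F 0 ga (pt_val z (Some cx)) (pt_val z (Some cy)) (pt_val z (Some ct)))
    by (intros z; apply indep_u; [assumption | apply (quadrant_gamma_u d v sym)]).
  assert (v_u : forall z : pt quadrant,
    phi z = F 1 phi (pt_val z (Some cx)) (pt_val z (Some cy)) (pt_val z (Some ct))
      * pt_val z None).
  { intros z; unfold phi, F.
    rewrite (ext_in _ (xytu _ _ _ 1) (quadrant_pos z)), !v_lambda; cbn.
    rewrite Rmult_1_r; f_equal; f_equal; extensionality i; destruct i; reflexivity. }
  assert (E : forall x y t u px py qxx qxy qyy, 0 < x -> 0 < y ->
    let ut := - (px / 4 + d * py + x / 2 * qxx + y / 2 * qyy) in
    (F 1 (dx phi) x y t * u + F 1 phi x y t * px - F 0 (dx xi) x y t * px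
      - F 0 (dx ga) x y t * py) / 4
    + d * (F 1 (dy phi) x y t * u + F 1 phi x y t * py - F 0 (dy xi) x y t * px
      - F 0 (dy ga) x y t * py)
    + (F 1 (dt phi) x y t * u + F 1 phi x y t * ut - F 0 (dt xi) x y t * px
      - F 0 (dt ga) x y t * py - T (dt tau) t * ut)
    + F 0 xi x y t / 2 * qxx + F 0 ga x y t / 2 * qyy
    + x / 2 * (F 1 (dx (dx phi)) x y t * u + 2 * px * F 1 (dx phi) x y t + qxx * F 1 phi x y t
      - 2 * qxx * F 0 (dx xi) x y t - 2 * qxy * F 0 (dx ga) x y t - px * F 0 (dx (dx xi)) x y t
      - py * F 0 (dx (dx ga)) x y t)
    + y / 2 * (F 1 (dy (dy phi)) x y t * u + 2 * py * F 1 (dy phi) x y t + qyy * F 1 phi x y t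
      - 2 * qxy * F 0 (dy xi) x y t - 2 * qyy * F 0 (dy ga) x y t - px * F 0 (dy (dy xi)) x y t
      - py * F 0 (dy (dy ga)) x y t) = 0).
  { intros x y t u px py qxx qxy qyy Hx Hy ut.
    pose proof (quadrant_symmetry_eq d v sym (quadrant_pt x y t u Hx Hy) px py qxx qxy qyy 0 0)
      as H; cbv zeta in H.
    rewrite (quadrant_pr2_reduced v _ _ _ _ _ _ _ _ _ _ _ _ _ _ _ _ _ _ _ _
      v_t v_x v_y v_u (dT _ sm_tau) (jF _ _ sm_xi) (jF _ _ sm_ga) (jF _ _ sm_phi)) in H.
    exact H. }
  destruct (quadrant_solutions d (T tau) (T (dt tau)) (T (dt (dt tau))) (T (dt (dt (dt tau))))
    (F 0 xi) (F 0 (dx xi)) (F 0 (dx (dx xi))) (F 0 (dy xi)) (F 0 (dy (dy xi))) (F 0 (dt xi))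
      (F 0 (dt (dt xi)))
    (F 0 ga) (F 0 (dx ga)) (F 0 (dx (dx ga))) (F 0 (dy ga)) (F 0 (dy (dy ga))) (F 0 (dt ga))
      (F 0 (dt (dt ga)))
    (F 1 phi) (F 1 (dx phi)) (F 1 (dx (dx phi))) (F 1 (dy phi)) (F 1 (dy (dy phi)))
      (F 1 (dt phi)))
    as [mE [mF [mH [mX [mY [mZ H]]]]]];
    [solve [auto 8] .. | | | | | | | | |].
  (* Comparison with the zero jet isolates one coefficient at a time: those of [u_xx], [u_yy],
     [u_xy], [u_x], [u_y] and finally [u]. *)
  - intros x y t Hx Hy.
    pose proof (E x y t 0 0 0 0 0 0 Hx Hy) as E0; pose proof (E x y t 0 0 0 1 0 0 Hx Hy) as E1.
    cbv zeta in E0, E1; lra.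
  - intros x y t Hx Hy.
    pose proof (E x y t 0 0 0 0 0 0 Hx Hy) as E0; pose proof (E x y t 0 0 0 0 0 1 Hx Hy) as E1.
    cbv zeta in E0, E1; lra.
  - intros x y t Hx Hy.
    pose proof (E x y t 0 0 0 0 0 0 Hx Hy) as E0; pose proof (E x y t 0 0 0 0 1 0 Hx Hy) as E1.
    cbv zeta in E0, E1; lra.
  - intros x y t Hx Hy.
    pose proof (E x y t 0 0 0 0 0 0 Hx Hy) as E0; pose proof (E x y t 0 1 0 0 0 0 Hx Hy) as E1.
    cbv zeta in E0, E1; lra.
  - intros x y t Hx Hy.
    pose proof (E x y t 0 0 0 0 0 0 Hx Hy) as E0; pose proof (E x y t 0 0 1 0 0 0 Hx Hy) as E1.
    cbv zeta in E0, E1; lra.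
  - intros x y t Hx Hy.
    pose proof (E x y t 1 0 0 0 0 0 Hx Hy) as E1; cbv zeta in E1; lra.
  - exact hd.
  - exact hd'.
  - exists mE, mF, mH, mX, mY, mZ; intros z x y t; destruct (quadrant_pos z) as [Zx Zy].
    destruct (H x y t Zx Zy) as [H1 [H2 [H3 H4]]].
    rewrite <- H1, <- H2, <- H3, <- H4; auto.
Qed.
End QuadrantExtraction.

(** The dictionary is E = v1, F = - v3, X = - v4, Y = v5, Z = v6 and H = 2 v2 - (2 d + 1/2) v6. The
    last is dictated by [E,F] = H: it is the derivative of the coefficients of v1 in t, including
    that of - 2 (1/4 + d) t u. The sign of X gives [X,Y] = Z. *)
Definition quadrant_field (d : R) (m : calM) : vspace quadrant := fun k z =>
  let x := pt_val z (Some cx) in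
  let y := pt_val z (Some cy) in
  let t := pt_val z (Some ct) in
  match k with
  | Some cx => 2 * m gE * t * x + 2 * m gH * x - m gX * t * sqrt x + m gY * sqrt x
  | Some cy => 2 * m gE * t * y + 2 * m gH * y
  | Some ct => m gE * t ^ 2 + 2 * m gH * t - m gF
  | None => (m gE * (2 * (x + y) - 2 * (1 / 4 + d) * t) - (2 * d + 1 / 2) * m gH
      - 2 * m gX * sqrt x + m gZ) * pt_val z None
  end.

Lemma quadrant_field_symmetry d m : calL (1 / 4) 0 d 0 (quadrant_field d m).
Proof.
  split; [split|].
  - intros [[]|]; cbn;
      smooth_tac open_quadrant
        ltac:(apply (smooth_sqrt open_quadrant); intros ? [? ?]; assumption).
  - intros z p q Hq Hpq; destruct (quadrant_pos z) as [Zx Zy].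
    rewrite (quadrant_pr2_reduced (quadrant_field d m)
      (fun t => m gE * t ^ 2 + 2 * m gH * t - m gF)
      (fun t => 2 * m gE * t + 2 * m gH)
      (fun x y t => 2 * m gE * t * x + 2 * m gH * x - m gX * t * sqrt x + m gY * sqrt x)
      (fun x y t => 2 * m gE * t + 2 * m gH + (m gY - m gX * t) / (2 * sqrt x))
      (fun x y t => - (m gY - m gX * t) / (4 * sqrt x ^ 3))
      (fun x y t => 0) (fun x y t => 0)
      (fun x y t => 2 * m gE * x - m gX * sqrt x)
      (fun x y t => 2 * m gE * t * y + 2 * m gH * y)
      (fun x y t => 0) (fun x y t => 0)
      (fun x y t => 2 * m gE * t + 2 * m gH)
      (fun x y t => 0)
      (fun x y t => 2 * m gE * y)
      (fun x y t => m gE * (2 * (x + y) - 2 * (1 / 4 + d) * t) - (2 * d + 1 / 2) * m gH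
        - 2 * m gX * sqrt x + m gZ)
      (fun x y t => 2 * m gE - m gX / sqrt x)
      (fun x y t => m gX / (2 * sqrt x ^ 3))
      (fun x y t => 2 * m gE) (fun x y t => 0)
      (fun x y t => - 2 * m gE * (1 / 4 + d)));
      try reflexivity;
      try (intros; auto_derive; [trivial | field]).
    2-4: constructor; intros x y t Hx Hy; pose proof (sqrt_lt_R0 x Hx);
      (auto_derive; [repeat split; lra | field; lra]).
    rewrite (Hq cy cx).
    unfold Delta2 in Hpq.
    (* Solves the equation for [u_t]: in [p ct - l] the occurrence of [p ct] inside [l] cancels, so
       [ut] is expressed by the other jet coordinates. *)
    match type of Hpq with ?l = 0 => assert (E : p ct = p ct - l) by (rewrite Hpq; ring) end.
    set (ut := p ct) in E at 1 |- *.
    rewrite E; clear E Hpq.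
    destruct (sqrt_pos_square _ Zx) as [Hr Hxx].
    set (x := pt_val z (Some cx)) in *; set (r := sqrt x) in *.
    rewrite Hxx; cbn; field; lra.
  - exists (fun w => m gE * (2 * (w cx + w cy) - 2 * (1 / 4 + d) * w ct) - (2 * d + 1 / 2) * m gH
      - 2 * m gX * sqrt (w cx) + m gZ).
    reflexivity.
Qed.

Lemma quadrant_field_surj d w : d <> 1 / 4 -> d <> 3 / 4 -> calL (1 / 4) 0 d 0 w ->
  exists m, quadrant_field d m = w.
Proof.
  intros hd hd' Hw.
  destruct (quadrant_form d w hd hd' Hw) as [mE [mF [mH [mX [mY [mZ H]]]]]].
  exists (fun g => match g with gE => mE | gF => mF | gH => mH | gX => mX | gY => mY
    | gZ => mZ end).
  extensionality k; extensionality z; destruct (H z) as [H1 [H2 [H3 H4]]].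
  destruct k as [[]|]; symmetry; assumption.
Qed.

Lemma quadrant_field_inj d m n : quadrant_field d m = quadrant_field d n -> m = n.
Proof.
  intros E.
  pose (P := fun t => quadrant_pt 1 1 t 1 Rlt_0_1 Rlt_0_1).
  assert (H : forall k t, quadrant_field d m k (P t) = quadrant_field d n k (P t))
    by (rewrite E; reflexivity).
  pose proof (H (Some ct) 0); pose proof (H (Some ct) 1); pose proof (H (Some ct) (-1)).
  pose proof (H (Some cx) 0); pose proof (H (Some cx) 1); pose proof (H None 0).
  cbn in *; rewrite sqrt_1 in *.
  (* In the coefficient of d_u the unknown [gH] is multiplied by [d], which [lra] cannot treat;
     identifying [gE], [gH], [gX] first leaves linear equations. *)
  assert (m gE = n gE) as HE by lra; assert (m gH = n gH) as HH by lra.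
  assert (m gX = n gX) as HX by lra; rewrite HE, HH, HX in *.
  extensionality g; destruct g; lra.
Qed.

Lemma quadrant_field_bracket d m n :
  quadrant_field d (mbracket m n) = vbracket (quadrant_field d m) (quadrant_field d n).
Proof.
  extensionality k; extensionality z.
  pose (c := fun (m : calM) (k : withU xyt_index) x y t u => match k with
    | Some cx => 2 * m gE * t * x + 2 * m gH * x - m gX * t * sqrt x + m gY * sqrt x
    | Some cy => 2 * m gE * t * y + 2 * m gH * y
    | Some ct => m gE * t ^ 2 + 2 * m gH * t - m gF
    | None => (m gE * (2 * (x + y) - 2 * (1 / 4 + d) * t) - (2 * d + 1 / 2) * m gH
        - 2 * m gX * sqrt x + m gZ) * u
    end).
  pose (cd := fun (m : calM) (j k : withU xyt_index) x y t u => match j, k with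
    | Some cx, Some cx => 2 * m gE * t + 2 * m gH + (m gY - m gX * t) / (2 * sqrt x)
    | Some ct, Some cx => 2 * m gE * x - m gX * sqrt x
    | Some cy, Some cy => 2 * m gE * t + 2 * m gH
    | Some ct, Some cy => 2 * m gE * y
    | Some ct, Some ct => 2 * m gE * t + 2 * m gH
    | Some cx, None => (2 * m gE - m gX / sqrt x) * u
    | Some cy, None => 2 * m gE * u
    | Some ct, None => - 2 * m gE * (1 / 4 + d) * u
    | None, None => m gE * (2 * (x + y) - 2 * (1 / 4 + d) * t) - (2 * d + 1 / 2) * m gH
        - 2 * m gX * sqrt x + m gZ
    | _, _ => 0
    end).
  destruct (quadrant_pos z) as [Zx Zy].
  destruct (sqrt_pos_square _ Zx) as [Hr Hxx].
  assert (P : forall m j k, partial j (quadrant_field d m k) z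
    = cd m j k (pt_val z (Some cx)) (pt_val z (Some cy)) (pt_val z (Some ct)) (pt_val z None)).
  { clear m n k; intros m [[]|] k.
    - apply (quadrant_partial_x _ (c m k)); destruct k as [[]|]; try reflexivity;
        unfold c, cd; cbn -[sqrt]; (auto_derive; [repeat split; exact Zx | field; lra]).
    - apply (quadrant_partial_y _ (c m k)); destruct k as [[]|]; try reflexivity;
        unfold c, cd; cbn -[sqrt]; (auto_derive; [trivial | field]).
    - apply (quadrant_partial_t _ (c m k)); destruct k as [[]|]; try reflexivity;
        unfold c, cd; cbn -[sqrt]; (auto_derive; [trivial | field]).
    - apply (quadrant_partial_u _ (c m k)); destruct k as [[]|]; try reflexivity;
        unfold c, cd; cbn -[sqrt]; (auto_derive; [trivial | field]). }
  unfold vbracket, isum; cbn [idx_enum withU xyt_index map fold_right]; rewrite !P.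
  destruct k as [[]|]; unfold quadrant_field, cd; cbn -[sqrt];
    set (x := pt_val z (Some cx)) in *; set (r := sqrt x) in *; rewrite Hxx; field; lra.
Qed.

Lemma calL_model d : d <> 1 / 4 -> d <> 3 / 4 ->
  is_lie_algebra (calL (1 / 4) 0 d 0) vbracket /\
  lie_isomorphic (calL (1 / 4) 0 d 0) vbracket allM mbracket /\
  lie_isomorphic allM mbracket (calL (1 / 4) 0 d 0) vbracket.
Proof.
  intros hd hd'.
  apply (lie_model (calL (1 / 4) 0 d 0) vbracket (quadrant_field d));
    eauto using quadrant_field_symmetry, quadrant_field_surj, quadrant_field_inj,
      quadrant_field_bracket.
  - intros m n; extensionality k; extensionality z; destruct k as [[]|]; cbn -[sqrt]; field.
  - intros c m; extensionality k; extensionality z; destruct k as [[]|]; cbn -[sqrt]; field.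
Qed.

(** * The basis v1, ..., v6 *)

Lemma lincomb_quadrant d c1 c2 c3 c4 c5 c6 :
  lincomb [c1; c2; c3; c4; c5; c6] [v1 d; v2; v3; v4; v5; v6]
  = quadrant_field d (fun g => match g with
      | gE => c1 | gF => - c3 | gH => c2 / 2 | gX => - c4 | gY => c5
      | gZ => c6 + (d + 1 / 4) * c2 end).
Proof.
  extensionality k; extensionality z; destruct k as [[]|]; cbn -[sqrt]; field.
Qed.

Lemma calL_basis d : d <> 1 / 4 -> d <> 3 / 4 ->
  is_basis (calL (1 / 4) 0 d 0) [v1 d; v2; v3; v4; v5; v6].
Proof.
  intros hd hd'.
  assert (len : forall c : list R, length c = 6%nat ->
    exists c1 c2 c3 c4 c5 c6, c = [c1; c2; c3; c4; c5; c6]).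
  { intros c Hc; do 6 (destruct c as [|? c]; [discriminate|]).
    destruct c; [repeat eexists | discriminate]. }
  constructor.
  - assert (H : forall v c1 c2 c3 c4 c5 c6,
        (* Each basis field is the combination with a unit coefficient vector, so its membership
           follows from that of all parametrized fields. *)
        lincomb [c1; c2; c3; c4; c5; c6] [v1 d; v2; v3; v4; v5; v6] = v ->
        calL (1 / 4) 0 d 0 v)
      by (intros; subst; rewrite lincomb_quadrant; apply quadrant_field_symmetry).
    intros v Hv; destruct Hv as [<-|[<-|[<-|[<-|[<-|[<-|[]]]]]]];
      [ apply (H _ 1 0 0 0 0 0) | apply (H _ 0 1 0 0 0 0) | apply (H _ 0 0 1 0 0 0)
      | apply (H _ 0 0 0 1 0 0) | apply (H _ 0 0 0 0 1 0) | apply (H _ 0 0 0 0 0 1) ];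
      extensionality k; extensionality z; destruct k as [[]|]; cbn -[sqrt]; ring.
  - intros c Hc H0 s Hs.
    destruct (len c Hc) as [c1 [c2 [c3 [c4 [c5 [c6 ->]]]]]].
    rewrite lincomb_quadrant in H0.
    assert (E : quadrant_field d (fun _ => 0) = zero)
      by (extensionality k; extensionality z; destruct k as [[]|]; cbn -[sqrt]; ring).
    rewrite <- E in H0; apply quadrant_field_inj in H0.
    pose proof (fun g => f_equal (fun m : calM => m g) H0) as Hg; cbn beta in Hg.
    pose proof (Hg gE); pose proof (Hg gF); pose proof (Hg gH); pose proof (Hg gX).
    pose proof (Hg gY); pose proof (Hg gZ) as HZ; cbn iota in *.
    assert (c2 = 0) by lra; subst c2.
    cbn in Hs; destruct Hs as [<-|[<-|[<-|[<-|[<-|[<-|[]]]]]]]; lra.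
  - intros v Hv; destruct (quadrant_field_surj d v hd hd' Hv) as [m <-].
    (* The inverse of the substitution in [lincomb_quadrant]; v2 has no u-component, so v6 takes up
       the part - (2 d + 1/2) u d_u of H. *)
    exists [m gE; 2 * m gH; - m gF; - m gX; m gY; m gZ - (2 * d + 1 / 2) * m gH].
    split; [reflexivity|]; rewrite lincomb_quadrant; f_equal.
    extensionality g; destruct g; lra.
Qed.

(* d = 3/4 is excluded because sqrt y d_y - u / (2 sqrt y) d_u is then a further symmetry. *)
Theorem mainTheorem12 (a b d e : R)
    (ha : a = 1 / 4) (hd : d <> 1 / 4) (hd' : d <> 3 / 4) (hb : b = 0) (he : e = 0) :
  is_lie_algebra (calL a b d e) vbracket /\
  has_dim (calL a b d e) 6 /\
  is_basis (calL a b d e) [v1 d; v2; v3; v4; v5; v6] /\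
  lie_isomorphic (calL a b d e) vbracket allM mbracket /\
  lie_isomorphic allM mbracket calH00 vbracket.
Proof.
  subst a b e.
  destruct (calL_model d hd hd') as [HL [HLM _]].
  pose proof (calL_basis d hd hd') as HB.
  split; [exact HL | split; [exists [v1 d; v2; v3; v4; v5; v6]; auto | split; [exact HB|]]].
  split; [exact HLM | apply calH00_model].
Qed.
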